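(* Let $n\ge1$. For every $s>0$, there exists a constant $\mathfrak{c}_s>0$ such that, for every $f,g\in L^2(\mathbb{H}^n)$, $$\bigl\|\,|(Q,P)|^s\,V_gf\bigr\|_2\ge\mathfrak{c}_s\,\|f\|_2\,\|g\|_2.$$
   Context: $\mathbb{H}^n=\mathbb{R}^n\times\mathbb{R}^n\times\mathbb{R}\cong\mathbb{R}^{2n+1}$ is the Heisenberg group with group law $(p,q,t)\cdot(p',q',t')=\left(p+p',q+q',t+t'+\tfrac12(pq'-qp')\right)$, where $pq$ is the Euclidean dot product on $\mathbb{R}^n$. Its Haar measure is Lebesgue measure on $\mathbb{R}^{2n+1}$, so $L^2(\mathbb{H}^n)=L^2(\mathbb{R}^{2n+1})$. $\mathcal{F}$ is the Euclidean Fourier transform on $\mathbb{R}^{2n+1}$, $\mathcal{F}(h)(Q)=\int_{\mathbb{R}^{2n+1}}h(X)e^{-2\pi i\langle Q,X\rangle}\,dX$, extended to a unitary operator on $L^2(\mathbb{R}^{2n+1})$; here $\langle Q,X\rangle$ is the Euclidean inner product on $\mathbb{R}^{2n+1}$. The short-time Fourier transform of $f\in L^2(\mathbb{H}^n)$ with window $g\in L^2(\mathbb{H}^n)$ is $$V_gf(Q,P)=\int_{\mathbb{R}^{2n+1}}\mathcal{F}(f)(X)\,\overline{\mathcal{F}(g)(X\cdot P)}\,e^{-2\pi i\langle Q,X\rangle}\,dX,\qquad Q,P\in\mathbb{H}^n,$$ with $X\cdot P$ the Heisenberg product. $|(Q,P)|$ denotes the Euclidean norm on $\mathbb{H}^n\times\mathbb{H}^n\cong\mathbb{R}^{2(2n+1)}$;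 the norm on the left is the $L^2(\mathbb{H}^n\times\mathbb{H}^n)$ norm (possibly $+\infty$). *)

(* Defs.v *)
From HB Require Import structures.
From mathcomp Require Export all_boot all_order all_algebra.
From mathcomp Require Export all_classical all_reals all_analysis.
From mathcomp.real_closed Require Export complex.

Set Implicit Arguments.
Unset Strict Implicit.
Unset Printing Implicit Defensive.
Import Order.TTheory GRing.Theory Num.Theory.
Import numFieldNormedType.Exports.

Local Open Scope classical_set_scope.
Local Open Scope ring_scope.

(* m1 \x m2 with its sigma-finite structure: on the bare product the canonical
   sigma-finite instance is shadowed by the one for subprobabilities. *)
Section sigma_finite_product.
Context {d1 d2} {T1 : measurableType d1} {T2 : measurableType d2} {R : realType}.
Variable m1 : {sigma_finite_measure set T1 -> \bar R}.
Variable m2 : {sigma_finite_measure set T2 -> \bar R}.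

Definition sfprod : set (T1 * T2) -> \bar R := (m1 \x m2)%E.

HB.instance Definition _ := Measure.on sfprod.

Let sfprod_sigma_finite : sigma_finite setT sfprod.
Proof.
have /sigma_finiteP[F [TF ndF Foo]] := sigma_finiteT m1.
have /sigma_finiteP[G [TG ndG Goo]] := sigma_finiteT m2.
exists (fun k => F k `*` G k).
  rewrite -setXTT TF TG predeqE => -[x y]; split.
    move=> [/= [k _ Fkx] [l _ Gly]]; exists (maxn k l) => //; split.
    - by move: x Fkx; exact/subsetPset/ndF/leq_maxl.
    - by move: y Gly; exact/subsetPset/ndG/leq_maxr.
  by move=> [k _ []/= ? ?]; split; exists k.
move=> k; have [? ?] := Foo k; have [? ?] := Goo k.
split; first exact: measurableX.
by rewrite /sfprod product_measure1E// lte_mul_pinfty// ge0_fin_numE.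
Qed.

HB.instance Definition _ := @Measure_isSigmaFinite.Build _ _ _ sfprod
  sfprod_sigma_finite.

End sigma_finite_product.

(* Lebesgue measure on R^n is built by recursion on n, as the image of
   lebesgue_measure \x (Lebesgue measure on R^n) under (a, x) |-> a :: x. *)
Section tuple_cons.
Context {R : realType} {n : nat}.
Local Notation mR := (measurableTypeR R).

Definition tcons (x : mR * n.-tuple mR) : n.+1.-tuple mR :=
  [the n.+1.-tuple mR of x.1 :: x.2].

Definition tuncons (t : n.+1.-tuple mR) : mR * n.-tuple mR :=
  (thead t, [tuple of behead t]).

Lemma tconsK : cancel tcons tuncons.
Proof.
case=> a x; rewrite /tuncons /tcons /=; congr pair.
exact: val_inj.
Qed.

Lemma tunconsK : cancel tuncons tcons.
Proof. by move=> t; rewrite [t in RHS]tuple_eta; exact: val_inj. Qed.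

Lemma measurable_tcons : measurable_fun [set: mR * n.-tuple mR] tcons.
Proof. exact: measurable_cons. Qed.

Lemma measurable_tuncons : measurable_fun [set: n.+1.-tuple mR] tuncons.
Proof.
apply/measurable_fun_pairP; split; last exact: measurable_behead.
exact: measurable_tnth.
Qed.

Variable m : {sigma_finite_measure set (n.-tuple mR) -> \bar R}.

Definition lebesgue_cons : set (n.+1.-tuple mR) -> \bar R :=
  pushforward (sfprod (@lebesgue_measure R) m) tcons.

Let lebesgue_cons0 : lebesgue_cons set0 = 0%E.
Proof. by rewrite /lebesgue_cons /pushforward preimage_set0 measure0. Qed.

Let lebesgue_cons_ge0 A : (0 <= lebesgue_cons A)%E.
Proof. by rewrite /lebesgue_cons /pushforward measure_ge0. Qed.

Let lebesgue_cons_sigma_additive : semi_sigma_additive lebesgue_cons.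
Proof.
apply: (@measure_semi_sigma_additive _ _ _ (pushforward _ _)).
exact: measurable_tcons.
Qed.

HB.instance Definition _ := isMeasure.Build _ _ _ lebesgue_cons
  lebesgue_cons0 lebesgue_cons_ge0 lebesgue_cons_sigma_additive.

Let lebesgue_cons_sigma_finite : sigma_finite setT lebesgue_cons.
Proof.
have [F UF Foo] := @sigma_finiteT _ _ _
  (sfprod (@lebesgue_measure R) m).
exists (fun k => tuncons @^-1` F k).
  by rewrite -preimage_bigcup -UF preimage_setT.
move=> k; have [mF Fk] := Foo k; split.
  by rewrite -[X in measurable X]setTI; exact: measurable_tuncons.
rewrite /lebesgue_cons /pushforward -comp_preimage.
by rewrite (_ : tuncons \o tcons = id)//; apply/funext => x /=; rewrite tconsK.
Qed.

HB.instance Definition _ := @Measure_isSigmaFinite.Build _ _ _ lebesgue_cons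
  lebesgue_cons_sigma_finite.

End tuple_cons.

Fixpoint lebesgue_tuple (R : realType) (n : nat) :
    {sigma_finite_measure set (n.-tuple (measurableTypeR R)) -> \bar R} :=
  if n is k.+1 then
    [the sigma_finite_measure _ _ of lebesgue_cons (lebesgue_tuple R k)]
  else [the sigma_finite_measure _ _ of \d_([tuple] : 0.-tuple (measurableTypeR R))].

(* The Borel sets are those of the product sigma-algebra. *)
Notation heis R n :=
  (n.-tuple (measurableTypeR R) * n.-tuple (measurableTypeR R)
   * measurableTypeR R)%type.

Section heisenberg.
Context {R : realType} {n : nat}.
Implicit Types (p q : n.-tuple (measurableTypeR R)) (X Y : heis R n).

Definition dot p q : R := \sum_(i < n) (tnth p i : R) * (tnth q i : R).

Definition addt p q : n.-tuple (measurableTypeR R) :=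
  [tuple (tnth p i : R) + (tnth q i : R) | i < n].

Definition heis_mul X Y : heis R n :=
  let: (p, q, t) := X in
  let: (p', q', t') := Y in
  (addt p p', addt q q',
   (t : R) + (t' : R) + 2^-1 * (dot p q' - dot q p')).

Definition heis_inner X Y : R :=
  dot X.1.1 Y.1.1 + dot X.1.2 Y.1.2 + (X.2 : R) * (Y.2 : R).

Definition pair_norm (Z : heis R n * heis R n) : R :=
  Num.sqrt (heis_inner Z.1 Z.1 + heis_inner Z.2 Z.2).

Definition lebesgue_heis : {sigma_finite_measure set (heis R n) -> \bar R} :=
  sfprod (sfprod (lebesgue_tuple R n) (lebesgue_tuple R n))
    (@lebesgue_measure R).

End heisenberg.

Arguments lebesgue_heis R n : clear implicits.

Section complex_valued.
Context {d} {T : measurableType d} {R : realType}.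
Variable mu : {measure set T -> \bar R}.
Implicit Types f : T -> R[i].

(* Junk value unless the real and imaginary parts are integrable. *)
Definition Cintegral f : R[i] :=
  Complex (\int[mu]_x complex.Re (f x))%R (\int[mu]_x complex.Im (f x))%R.

Definition CLnorm (p : \bar R) f : \bar R :=
  Lnorm mu p (fun x => (Normc.normc (f x))%:E).

Definition CLp (p : \bar R) f : Prop :=
  [/\ measurable_fun setT (fun x => complex.Re (f x)),
      measurable_fun setT (fun x => complex.Im (f x))
    & (CLnorm p f < +oo)%E].

End complex_valued.

Definition expi {R : realType} (a : R) : R[i] := Complex (cos a) (sin a).

Section fourier.
Context {R : realType} {n : nat}.
Local Notation mu := (lebesgue_heis R n).
Implicit Types (f g h F : heis R n -> R[i]) (Q P X : heis R n).

Definition fourier_int h Q : R[i] :=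
  Cintegral mu (fun X => h X * expi (- (2 * pi * heis_inner Q X))).

(* F belongs to the closure in L^2 x L^2 of the graph of fourier_int on the
   intersection of L^1 and L^2, that is, F is a representative of the image of
   f under the unitary extension. *)
Definition is_fourier f F : Prop :=
  CLp mu 2%:E F /\
  exists h : nat -> heis R n -> R[i],
    [/\ forall k, CLp mu 1%:E (h k) /\ CLp mu 2%:E (h k),
        (fun k => CLnorm mu 2%:E (fun X => h k X - f X)) @ \oo --> 0%E
      & (fun k => CLnorm mu 2%:E (fun X => fourier_int (h k) X - F X)) @ \oo
          --> 0%E].

(* A choice of representative; the default 0 is never used for f in L^2, by
   Plancherel's theorem. *)
Definition fourier f : heis R n -> R[i] :=
  xget (fun=> 0) [set F | is_fourier f F].

(* V_g f (Q, P); the value depends only on the classes of fourier f and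
   fourier g modulo null sets, right translations preserving mu. *)
Definition stft g f (Z : heis R n * heis R n) : R[i] :=
  Cintegral mu (fun X =>
    fourier f X * (fourier g (heis_mul X Z.2))^*%C
      * expi (- (2 * pi * heis_inner Z.1 X))).

End fourier.

(* Main.v *)
Require Import Defs.
From mathcomp Require Import ring lra measurable_realfun.
Import Order.TTheory GRing.Theory Num.Theory.
Import numFieldNormedType.Exports.
Set Implicit Arguments.
Unset Strict Implicit.
Unset Printing Implicit Defensive.
Local Open Scope classical_set_scope.
Local Open Scope ring_scope.

(* Write phi and psi for the Fourier transforms of f and g. For fixed P, V_g f(., P)
   is the Fourier transform of X |-> phi(X) conj(psi(X . P)), so Plancherel's
   identity and the invariance of Haar measure under P |-> X . P give
   ||V_g f|| = ||phi|| ||psi||, while the Cauchy-Schwarz inequality bounds |V_g f|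
   pointwise by a multiple of ||phi|| ||psi||. A small enough ball around 0 thus
   carries at most half of ||V_g f||^2, and outside of it |(Q, P)|^s is bounded
   below.

   Plancherel's identity is proved for integrable square-integrable functions,
   first on the line, where the Abel means of |F a|^2 are
   ||a||^2 - 1/2 iint (a(x) - a(y))^2 K_c(x - y) dx dy for the Poisson kernel K_c,
   and the double integral vanishes with c because translations are continuous in
   L^2. It passes to products one variable at a time, and to L^2 by completeness.
   As the constant is free, ||f|| <= 2 ||phi|| is enough in the last step. *)

(** * Complex-valued measurable and integrable functions *)

(** Norms are handled through extended-real integrals of [nsq]: it is a polynomial in the real and
    imaginary parts, so identities reduce to ring computations, and |z + w|^2 <= 2 |z|^2 + 2 |w|^2
    replaces Minkowski's inequality. Using the latter twice is what costs the factor in ||f|| <= 2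
    ||phi||.

    [fourier] is a choice with default 0, and a default value would make V_g f vanish and the
    theorem fail. Hence an L^2 transform has to be shown to exist for every f in L^2; an estimate
    for a given transform is not enough.

    Abel weights are convenient because the weight and its kernel have elementary antiderivatives
    (an exponential times sines and cosines, and an arctangent), so that no Gaussian integral and no
    inversion formula enters. For a real-valued function the squared transform is a double cosine
    integral, to which they apply directly; complex values are recovered from the symmetry between q
    and -q.

    Apart from measurability, the group law matters only through two invariances: under right
    translations, for X at fixed P, and under left translations, for P at fixed X. *)

Definition nsq {R : realType} (z : R[i]) : R :=
  complex.Re z ^+ 2 + complex.Im z ^+ 2.

Section nsq.
Context {R : realType}.
Implicit Types z w : R[i].

Lemma nsq_ge0 z : 0 <= nsq z.
Proof. by rewrite addr_ge0 ?sqr_ge0. Qed.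

Lemma nsqM z w : nsq (z * w) = nsq z * nsq w.
Proof. by case: z w => [a b] [c d]; rewrite /nsq /=; ring. Qed.

Lemma nsq_conj z : nsq z^*%C = nsq z.
Proof. by case: z => a b; rewrite /nsq /= sqrrN. Qed.

Lemma nsq_expi (a : R) : nsq (expi a) = 1.
Proof. by rewrite /nsq /= cos2Dsin2. Qed.

Lemma nsq_realC (a : R) : nsq a%:C%C = a ^+ 2.
Proof. by rewrite /nsq /= expr0n addr0. Qed.

Lemma normc_ge0 z : 0 <= Normc.normc z.
Proof. by case: z => a b; exact: sqrtr_ge0. Qed.

Lemma sqr_normcE z : Normc.normc z ^+ 2 = nsq z.
Proof. by case: z => a b; rewrite sqr_sqrtr// addr_ge0// sqr_ge0. Qed.

Lemma nsqD_le z w : nsq (z + w) <= 2 * nsq z + 2 * nsq w.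
Proof.
case: z w => [a b] [c d]; rewrite /nsq /=.
have := sqr_ge0 (a - c); have := sqr_ge0 (b - d); nra.
Qed.

Lemma normr_Re_le z : `|complex.Re z| <= Normc.normc z.
Proof.
rewrite -(ler_pXn2r (ltn0Sn 1)) ?nnegrE ?normc_ge0// sqr_normcE real_normK ?num_real//.
by rewrite lerDl sqr_ge0.
Qed.

Lemma normr_Im_le z : `|complex.Im z| <= Normc.normc z.
Proof.
rewrite -(ler_pXn2r (ltn0Sn 1)) ?nnegrE ?normc_ge0// sqr_normcE real_normK ?num_real//.
by rewrite lerDr sqr_ge0.
Qed.

Lemma normc_le z : Normc.normc z <= `|complex.Re z| + `|complex.Im z|.
Proof.
rewrite -(ler_pXn2r (ltn0Sn 1)) ?nnegrE ?normc_ge0 ?addr_ge0// sqr_normcE.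
by rewrite sqrrD !real_normK ?num_real// /nsq addrAC lerDl mulrn_wge0// mulr_ge0.
Qed.

Lemma nsqN z : nsq (- z) = nsq z.
Proof. by case: z => a b; rewrite /nsq /= !sqrrN. Qed.

Lemma normcM_expi z (a : R) : Normc.normc (z * expi a) = Normc.normc z.
Proof.
apply/eqP; rewrite -(eqrXn2 (ltn0Sn 1)) ?normc_ge0//.
by rewrite !sqr_normcE nsqM nsq_expi mulr1.
Qed.

Lemma expiD (a b : R) : expi (a + b) = expi a * expi b.
Proof. by rewrite /expi cosD sinD; congr Complex; rewrite addrC mulrC. Qed.

End nsq.

Definition Cmeasurable {d} {T : measurableType d} {R : realType}
    (h : T -> R[i]) : Prop :=
  measurable_fun setT (fun x => complex.Re (h x)) /\
  measurable_fun setT (fun x => complex.Im (h x)).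

Section Cmeasurable.
Context {d} {T : measurableType d} {R : realType}.
Implicit Types h k : T -> R[i].

Lemma Cmeasurable_comp {d'} {S : measurableType d'} (u : S -> T) h :
  measurable_fun setT u -> Cmeasurable h -> Cmeasurable (h \o u).
Proof.
by move=> mu [mr mi]; split;
  [exact: (measurableT_comp mr mu)|exact: (measurableT_comp mi mu)].
Qed.

Lemma CmeasurableM h k : Cmeasurable h -> Cmeasurable k ->
  Cmeasurable (fun x => h x * k x).
Proof.
move=> [hr hi] [kr ki]; split.
- rewrite (_ : (fun _ => _) = (fun x => complex.Re (h x) * complex.Re (k x)
    - complex.Im (h x) * complex.Im (k x))).
    by apply: measurable_funB; exact: measurable_funM.
  by apply/funext => x; case: (h x) (k x) => ? ? [].
- rewrite (_ : (fun _ => _) = (fun x => complex.Re (h x) * complex.Im (k x)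
    + complex.Im (h x) * complex.Re (k x))).
    by apply: measurable_funD; exact: measurable_funM.
  by apply/funext => x; case: (h x) (k x) => ? ? [].
Qed.

Lemma CmeasurableB h k : Cmeasurable h -> Cmeasurable k ->
  Cmeasurable (fun x => h x - k x).
Proof.
move=> [hr hi] [kr ki]; split.
- rewrite (_ : (fun _ => _) =
      (fun x => complex.Re (h x) - complex.Re (k x))).
    exact: measurable_funB.
  by apply/funext => x; case: (h x) (k x) => ? ? [].
- rewrite (_ : (fun _ => _) =
      (fun x => complex.Im (h x) - complex.Im (k x))).
    exact: measurable_funB.
  by apply/funext => x; case: (h x) (k x) => ? ? [].
Qed.

Lemma Cmeasurable_conj h : Cmeasurable h -> Cmeasurable (fun x => (h x)^*%C).
Proof.
move=> [hr hi]; split.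
- rewrite (_ : (fun _ => _) = (fun x => complex.Re (h x)))//.
  by apply/funext => x; case: (h x).
- rewrite (_ : (fun _ => _) = (fun x => - complex.Im (h x))).
    exact: measurable_funN.
  by apply/funext => x; case: (h x).
Qed.

Lemma Cmeasurable_expi (a : T -> R) : measurable_fun setT a ->
  Cmeasurable (fun x => expi (a x)).
Proof.
move=> ma; split => /=.
- by apply: (measurableT_comp _ ma); apply: continuous_measurable_fun;
    exact: continuous_cos.
- by apply: (measurableT_comp _ ma); apply: continuous_measurable_fun;
    exact: continuous_sin.
Qed.

Lemma Cmeasurable_realC (a : T -> R) : measurable_fun setT a ->
  Cmeasurable (fun x => (a x)%:C%C).
Proof. by move=> ma; split. Qed.

Lemma measurable_nsq h : Cmeasurable h -> measurable_fun setT (fun x => nsq (h x)).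
Proof. by move=> [mr mi]; apply: measurable_funD; exact: measurable_funX. Qed.

Lemma measurable_normc h : Cmeasurable h ->
  measurable_fun setT (fun x => Normc.normc (h x)).
Proof.
move=> mh; rewrite (_ : (fun _ => _) = (fun x => Num.sqrt (nsq (h x)))).
  apply: (measurableT_comp _ (measurable_nsq mh)).
  by apply: continuous_measurable_fun; exact: sqrt_continuous.
by apply/funext => x; rewrite -sqr_normcE sqrtr_sqr ger0_norm ?normc_ge0.
Qed.

End Cmeasurable.

Section Cintegrable.
Context {d} {T : measurableType d} {R : realType}.
Variable mu : {measure set T -> \bar R}.
Implicit Types (h k : T -> R[i]) (g : T -> R).

Definition Cintegrable h : Prop :=
  mu.-integrable setT (EFin \o (fun x => complex.Re (h x))) /\
  mu.-integrable setT (EFin \o (fun x => complex.Im (h x))).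

Lemma Cintegrable_Cmeasurable h : Cintegrable h -> Cmeasurable h.
Proof.
by move=> [/measurable_int/measurable_EFinP ? /measurable_int/measurable_EFinP].
Qed.

Lemma le_Cintegrable h g : Cmeasurable h ->
  mu.-integrable setT (EFin \o g) ->
  (forall x, Normc.normc (h x) <= g x) -> Cintegrable h.
Proof.
move=> [mr mi] ig hg; split; apply: le_integrable ig => //=.
- exact/measurable_EFinP.
- move=> x _; rewrite lee_fin (le_trans (normr_Re_le _))// (le_trans (hg x))//.
  exact: ler_norm.
- exact/measurable_EFinP.
- move=> x _; rewrite lee_fin (le_trans (normr_Im_le _))// (le_trans (hg x))//.
  exact: ler_norm.
Qed.

Lemma Cintegrable_normc h : Cintegrable h ->
  mu.-integrable setT (EFin \o (fun x => Normc.normc (h x))).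
Proof.
move=> ih; have mh := Cintegrable_Cmeasurable ih; case: ih => ir ii.
have := integrableD measurableT (integrable_abse ir) (integrable_abse ii).
apply: le_integrable => //=.
  by apply/measurable_EFinP; exact: measurable_normc.
move=> x _; rewrite lee_fin (ger0_norm (normc_ge0 _)).
by rewrite (le_trans (normc_le _))// ler_norm.
Qed.

Lemma CintegrableB h k : Cintegrable h -> Cintegrable k ->
  Cintegrable (fun x => h x - k x).
Proof.
move=> [hr hi] [kr ki]; split.
- apply: eq_integrable (integrableB measurableT hr kr) => //= x _.
  by case: (h x) (k x) => ? ? [].
- apply: eq_integrable (integrableB measurableT hi ki) => //= x _.
  by case: (h x) (k x) => ? ? [].
Qed.

Lemma CintegralZl (c : R[i]) h : Cintegrable h ->
  Cintegral mu (fun x => c * h x) = c * Cintegral mu h.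
Proof.
have iZ (a : R) g : mu.-integrable setT (EFin \o g) ->
    mu.-integrable setT (EFin \o (fun x => a * g x)).
  by move=> /(integrableZl measurableT a); exact: eq_integrable.
case: c => a b [hr hi]; rewrite /Cintegral; congr Complex.
- rewrite -!RintegralZl// -RintegralB//; [|exact: iZ|exact: iZ].
  by apply: eq_Rintegral => x _; case: (h x).
- rewrite -!RintegralZl// -RintegralD//; [|exact: iZ|exact: iZ].
  by apply: eq_Rintegral => x _; case: (h x).
Qed.

Lemma CintegralB h k : Cintegrable h -> Cintegrable k ->
  Cintegral mu (fun x => h x - k x) = Cintegral mu h - Cintegral mu k.
Proof.
move=> [hr hi] [kr ki]; rewrite /Cintegral; congr Complex.
- rewrite -RintegralB//; apply: eq_Rintegral => x _.
  by case: (h x) (k x) => ? ? [].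
- rewrite -RintegralB//; apply: eq_Rintegral => x _.
  by case: (h x) (k x) => ? ? [].
Qed.

(** Integrability is not assumed: if the integral of [g] is infinite, [fine] sends it to 0 and the
    bound is trivial. *)
Lemma normr_Rintegral_le g : measurable_fun setT g ->
  (`| \int[mu]_x g x |%:E <= \int[mu]_x `|(g x)%:E|)%E.
Proof.
move=> mg; apply: (le_trans _ (le_abse_integral mu measurableT _)).
  rewrite /Rintegral; case: (\int[mu]_x (g x)%:E)%E => //= [|];
    by rewrite normr0 leey.
exact/measurable_EFinP.
Qed.

Lemma normr_Re_Cintegral h : Cmeasurable h ->
  (`| complex.Re (Cintegral mu h) |%:E <= \int[mu]_x (Normc.normc (h x))%:E)%E.
Proof.
move=> mh; apply: (le_trans (normr_Rintegral_le mh.1)).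
apply: ge0_le_integral => //.
- by apply: measurableT_comp => //; apply/measurable_EFinP; exact: mh.1.
- by apply/measurable_EFinP; exact: measurable_normc.
- by move=> x _; rewrite lee_fin normr_Re_le.
Qed.

Lemma normr_Im_Cintegral h : Cmeasurable h ->
  (`| complex.Im (Cintegral mu h) |%:E <= \int[mu]_x (Normc.normc (h x))%:E)%E.
Proof.
move=> mh; apply: (le_trans (normr_Rintegral_le mh.2)).
apply: ge0_le_integral => //.
- by apply: measurableT_comp => //; apply/measurable_EFinP; exact: mh.2.
- by apply/measurable_EFinP; exact: measurable_normc.
- by move=> x _; rewrite lee_fin normr_Im_le.
Qed.

End Cintegrable.

(** * Fubini's theorem and the Fourier transform attached to a pairing *)

Section fubini.
Context {d1 d2} {T1 : measurableType d1} {T2 : measurableType d2} {R : realType}.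
Variable m1 : {sigma_finite_measure set T1 -> \bar R}.
Variable m2 : {sigma_finite_measure set T2 -> \bar R}.

(** No integrability of the sections is assumed. The integrals of the positive and negative parts
    are measurable by Tonelli, and so are their extended-real difference and its image under
    [fine]. *)
Lemma measurable_Rintegral (f : T1 * T2 -> R) : measurable_fun setT f ->
  measurable_fun setT (fun x => \int[m2]_y f (x, y)).
Proof.
move=> mf; apply: (measurableT_comp (fine_measurable measurableT)).
have mf' : measurable_fun setT (EFin \o f) by exact/measurable_EFinP.
rewrite (_ : (fun _ => _) =
  (fun x => \int[m2]_y (EFin \o f)^\+ (x, y) -
            \int[m2]_y (EFin \o f)^\- (x, y))%E); last first.
  apply/funext => x; rewrite integralE; congr (_ - _)%E;
    by apply: eq_integral => y _; rewrite ?funeposE ?funenegE.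
apply: emeasurable_funB.
- exact: (measurable_fun_fubini_tonelli_F (m2 := m2) _ (measurable_funepos mf')).
- exact: (measurable_fun_fubini_tonelli_F (m2 := m2) _ (measurable_funeneg mf')).
Qed.

Lemma Cmeasurable_Cintegral (h : T1 * T2 -> R[i]) : Cmeasurable h ->
  Cmeasurable (fun x => Cintegral m2 (fun y => h (x, y))).
Proof.
move=> [mr mi]; split => /=.
- exact: (measurable_Rintegral mr).
- exact: (measurable_Rintegral mi).
Qed.

(** The inner integral is finite only almost everywhere; there [fine] changes nothing, and this is
    enough for the outer integral. *)
Lemma Rfubini (f : T1 * T2 -> R) :
  (m1 \x m2)%E.-integrable setT (EFin \o f) ->
  \int[(m1 \x m2)%E]_z f z = \int[m1]_x \int[m2]_y f (x, y).
Proof.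
move=> intf; have mf := measurable_int _ intf; congr fine.
rewrite -(integral12_prod_meas1 intf).
apply: ae_eq_integral; [by []|exact: (measurable_fubini_F intf)|..].
- by apply/measurable_EFinP; apply: measurable_Rintegral; exact/measurable_EFinP.
- have := ae_integrable1 intf; apply: filterS => x /= ix _.
  by rewrite /Rintegral fineK//; exact: integrable_fin_num.
Qed.

Lemma Cfubini (h : T1 * T2 -> R[i]) : Cintegrable (sfprod m1 m2) h ->
  Cintegral (sfprod m1 m2) h =
  Cintegral m1 (fun x => Cintegral m2 (fun y => h (x, y))).
Proof.
move=> [ir ii]; rewrite /Cintegral /=; congr Complex.
- exact: (Rfubini ir).
- exact: (Rfubini ii).
Qed.

Lemma Cintegrable_ae1 (h : T1 * T2 -> R[i]) : Cintegrable (sfprod m1 m2) h ->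
  {ae m1, forall x, Cintegrable m2 (fun y => h (x, y))}.
Proof.
move=> [ir ii]; near=> x; split.
- by near: x; have := ae_integrable1 ir; exact: filterS.
- by near: x; have := ae_integrable1 ii; exact: filterS.
Unshelve. all: by end_near. Qed.

End fubini.

Section fourier_transform.
Context {d} {T : measurableType d} {R : realType}.
Variables (mu : {sigma_finite_measure set T -> \bar R}) (B : T -> T -> R).

(** The pairing is a parameter so that the line, the spaces R^n and the Heisenberg group are
    instances of one definition, and Plancherel's identity can be passed to products and image
    measures. [fourier_int] is the instance for [heis_inner], by conversion. *)
Definition ft (h : T -> R[i]) (xi : T) : R[i] :=
  Cintegral mu (fun x => h x * expi (- (2 * pi * B xi x))).

Definition plancherel : Prop := forall h : T -> R[i],
  Cintegrable mu h -> (\int[mu]_x (nsq (h x))%:E < +oo)%E ->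
  (\int[mu]_x (nsq (ft h x))%:E = \int[mu]_x (nsq (h x))%:E)%E.

Hypothesis mB : measurable_fun setT (fun z : T * T => B z.1 z.2).

Lemma measurable_character xi :
  Cmeasurable (fun x => expi (- (2 * pi * B xi x))).
Proof.
apply: Cmeasurable_expi; apply: measurable_funN; apply: measurable_funM => //.
exact: (measurableT_comp mB (measurable_pair1 xi)).
Qed.

Lemma Cintegrable_character h xi : Cintegrable mu h ->
  Cintegrable mu (fun x => h x * expi (- (2 * pi * B xi x))).
Proof.
move=> ih; have mh := Cintegrable_Cmeasurable ih.
apply: (le_Cintegrable _ (Cintegrable_normc ih)).
  by apply: CmeasurableM => //; exact: measurable_character.
by move=> x; rewrite normcM_expi.
Qed.

(** Joint measurability in the frequency and a spectator variable: the latter is the untransformed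
    coordinate of a product, and later the point P of the short-time transform. *)
Lemma Cmeasurable_ft2 {d'} {S : measurableType d'} (h : S * T -> R[i]) :
  Cmeasurable h ->
  Cmeasurable (fun z : S * T => ft (fun y => h (z.1, y)) z.2).
Proof.
move=> mh; apply: (@Cmeasurable_Cintegral _ _ _ _ _ mu (fun w : (S * T) * T =>
  h (w.1.1, w.2) * expi (- (2 * pi * B w.1.2 w.2)))).
apply: CmeasurableM.
  apply: (@Cmeasurable_comp _ _ _ _ _
    (fun w : S * T * T => (w.1.1, w.2)) h) => //.
  apply: measurable_fun_pair; last exact: measurable_snd.
  exact: (measurableT_comp measurable_fst measurable_fst).
apply: Cmeasurable_expi; apply: measurable_funN; apply: measurable_funM => //.
apply: (measurableT_comp mB (_ : measurable_fun setT
  (fun w : S * T * T => (w.1.2, w.2)))).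
apply: measurable_fun_pair; last exact: measurable_snd.
exact: (measurableT_comp measurable_snd measurable_fst).
Qed.

Lemma Cmeasurable_ft h : Cmeasurable h -> Cmeasurable (ft h).
Proof.
move=> mh; have := @Cmeasurable_ft2 _ T (h \o snd).
move=> /(_ (Cmeasurable_comp measurable_snd mh)).
by move=> /(Cmeasurable_comp (measurable_pair1 point)).
Qed.

Lemma ftB h k : Cintegrable mu h -> Cintegrable mu k ->
  ft (fun x => h x - k x) = (fun xi => ft h xi - ft k xi).
Proof.
move=> ih ik; apply/funext => xi; rewrite /ft -CintegralB.
- by congr Cintegral; apply/funext => x; rewrite mulrBl.
- exact: Cintegrable_character.
- exact: Cintegrable_character.
Qed.

End fourier_transform.

Section tensor.
Context {d1 d2} {T1 : measurableType d1} {T2 : measurableType d2} {R : realType}.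
Variable m1 : {sigma_finite_measure set T1 -> \bar R}.
Variable m2 : {sigma_finite_measure set T2 -> \bar R}.
Variables (B1 : T1 -> T1 -> R) (B2 : T2 -> T2 -> R).
Hypothesis mB1 : measurable_fun setT (fun z : T1 * T1 => B1 z.1 z.2).
Hypothesis mB2 : measurable_fun setT (fun z : T2 * T2 => B2 z.1 z.2).

Definition add_pairing (u v : T1 * T2) : R := B1 u.1 v.1 + B2 u.2 v.2.

Lemma measurable_add_pairing :
  measurable_fun setT (fun z : (T1 * T2) * (T1 * T2) => add_pairing z.1 z.2).
Proof.
apply: measurable_funD.
- apply: (measurableT_comp mB1 (_ : measurable_fun setT
    (fun z : (T1 * T2) * (T1 * T2) => (z.1.1, z.2.1)))).
  apply: measurable_fun_pair.
    exact: (measurableT_comp measurable_fst measurable_fst).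
  exact: (measurableT_comp measurable_fst measurable_snd).
- apply: (measurableT_comp mB2 (_ : measurable_fun setT
    (fun z : (T1 * T2) * (T1 * T2) => (z.1.2, z.2.2)))).
  apply: measurable_fun_pair.
    exact: (measurableT_comp measurable_snd measurable_fst).
  exact: (measurableT_comp measurable_snd measurable_snd).
Qed.

Lemma ft_tensor h u : Cintegrable (sfprod m1 m2) h ->
  ft (sfprod m1 m2) add_pairing h u =
  ft m1 B1 (fun x => ft m2 B2 (fun y => h (x, y)) u.2) u.1.
Proof.
move=> ih; rewrite {1}/ft Cfubini; last first.
  exact: (Cintegrable_character measurable_add_pairing).
have mh := Cintegrable_Cmeasurable ih.
(* The character of the first variable leaves the inner integral by linearity, which needs an
   integrable fibre; hence only almost every x. *)
have key : {ae m1, forall x,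
    Cintegral m2 (fun y => h (x, y) * expi (- (2 * pi * add_pairing u (x, y))))
    = ft m2 B2 (fun y => h (x, y)) u.2 * expi (- (2 * pi * B1 u.1 x))}.
  have := Cintegrable_ae1 ih; apply: filterS => x ihx.
  rewrite [RHS]mulrC [in RHS]/ft -CintegralZl; last exact: Cintegrable_character.
  congr Cintegral; apply/funext => y.
  by rewrite mulrCA -expiD /add_pairing /= mulrDr opprD.
have mL : Cmeasurable (fun x => Cintegral m2 (fun y =>
    h (x, y) * expi (- (2 * pi * add_pairing u (x, y))))).
  apply: (@Cmeasurable_Cintegral _ _ _ _ _ m2
    (fun z => h z * expi (- (2 * pi * add_pairing u z)))).
  by apply: CmeasurableM => //; exact: measurable_character measurable_add_pairing _.
have mR : Cmeasurable (fun x =>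
    ft m2 B2 (fun y => h (x, y)) u.2 * expi (- (2 * pi * B1 u.1 x))).
  apply: CmeasurableM; last exact: measurable_character.
  exact: (Cmeasurable_comp (measurable_pair2 u.2)
    (Cmeasurable_ft2 m2 mB2 mh)).
rewrite /ft -/(Cintegral _ _) {1}/Cintegral {3}/Cintegral; congr Complex; congr fine.
- apply: ae_eq_integral => //; [exact/measurable_EFinP/mL.1|
    exact/measurable_EFinP/mR.1|].
  by apply: filterS key => x -> _.
- apply: ae_eq_integral => //; [exact/measurable_EFinP/mL.2|
    exact/measurable_EFinP/mR.2|].
  by apply: filterS key => x -> _.
Qed.

End tensor.

(** * Plancherel's identity: products and transport *)

Section nonneg.
Context {d} {T : measurableType d} {R : realType}.
Variable mu : {measure set T -> \bar R}.

Lemma ge0_integrableP (f : T -> R) : measurable_fun setT f ->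
  (forall x, 0 <= f x) ->
  mu.-integrable setT (EFin \o f) <-> (\int[mu]_x (f x)%:E < +oo)%E.
Proof.
move=> mf f0; split.
- move=> /integrableP[_]; under eq_integral do rewrite /= ger0_norm//.
  by [].
- move=> fi; apply/integrableP; split; first exact/measurable_EFinP.
  by under eq_integral do rewrite /= ger0_norm//.
Qed.

Lemma integrable_nsqP (h : T -> R[i]) : Cmeasurable h ->
  mu.-integrable setT (EFin \o (fun x => nsq (h x))) <->
  (\int[mu]_x (nsq (h x))%:E < +oo)%E.
Proof.
by move=> mh; apply: ge0_integrableP; [exact: measurable_nsq|move=> x; exact: nsq_ge0].
Qed.

End nonneg.

Section plancherel_tensor.
Context {d1 d2} {T1 : measurableType d1} {T2 : measurableType d2} {R : realType}.
Variable m1 : {sigma_finite_measure set T1 -> \bar R}.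
Variable m2 : {sigma_finite_measure set T2 -> \bar R}.
Variables (B1 : T1 -> T1 -> R) (B2 : T2 -> T2 -> R).
Hypothesis mB1 : measurable_fun setT (fun z : T1 * T1 => B1 z.1 z.2).
Hypothesis mB2 : measurable_fun setT (fun z : T2 * T2 => B2 z.1 z.2).

(* The transform on the product is a partial transform in the second variable
   followed by one in the first; each is isometric on almost every fibre. *)
Lemma plancherel_tensor : plancherel m1 B1 -> plancherel m2 B2 ->
  plancherel (sfprod m1 m2) (add_pairing B1 B2).
Proof.
move=> P1 P2 h ih nh; have mh := Cintegrable_Cmeasurable ih.
pose k (z : T1 * T2) := ft m2 B2 (fun y => h (z.1, y)) z.2.
have mk : Cmeasurable k := Cmeasurable_ft2 m2 mB2 mh.
have mnk : measurable_fun setT (fun z => (nsq (k z))%:E).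
  by apply/measurable_EFinP; exact: measurable_nsq.
have mnh : measurable_fun setT (fun z => (nsq (h z))%:E).
  by apply/measurable_EFinP; exact: measurable_nsq.
have nk0 z : (0 <= (nsq (k z))%:E)%E by rewrite lee_fin nsq_ge0.
have nh0 z : (0 <= (nsq (h z))%:E)%E by rewrite lee_fin nsq_ge0.
(* |k(x, eta)| is at most the integral of |h(x, y)| in y, a bound independent of eta; so
   integrability in x holds for every eta, not just almost every one. *)
have kL1 eta : Cintegrable m1 (fun x => k (x, eta)).
  have mke : Cmeasurable (fun x => k (x, eta)).
    exact: (Cmeasurable_comp (measurable_pair2 eta) mk).
  have mhe x : Cmeasurable (fun y =>
      h (x, y) * expi (- (2 * pi * B2 eta y))).
    apply: CmeasurableM; last exact: measurable_character.
    exact: (Cmeasurable_comp (measurable_pair1 x) mh).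
  have ig := integrable_fubini_F (Cintegrable_normc ih).
  have bnd x : (\int[m2]_y (Normc.normc (h (x, y) *
      expi (- (2 * pi * B2 eta y))))%:E <=
      `|fubini_F m2 (EFin \o (fun x0 => Normc.normc (h x0))) x|)%E.
    apply: (le_trans _ (lee_abs _)); rewrite /fubini_F.
    by rewrite le_eqVlt; apply/orP; left; apply/eqP/eq_integral => y _; rewrite normcM_expi.
  split; apply: le_integrable ig => //.
  - by apply/measurable_EFinP; exact: mke.1.
  - move=> x _; apply: (le_trans _ (bnd x)).
    exact: (normr_Re_Cintegral m2 (mhe x)).
  - by apply/measurable_EFinP; exact: mke.2.
  - move=> x _; apply: (le_trans _ (bnd x)).
    exact: (normr_Im_Cintegral m2 (mhe x)).
have inh : (m1 \x m2)%E.-integrable setT (EFin \o (fun z => nsq (h z))).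
  exact/(integrable_nsqP _ mh).
have kN : (\int[m1]_x \int[m2]_eta (nsq (k (x, eta)))%:E =
    \int[(m1 \x m2)%E]_z (nsq (h z))%:E)%E.
  rewrite (fubini_tonelli1 (m1 := m1) (m2 := m2) _ mnh nh0).
  apply: ge0_ae_eq_integral; [by []|..].
  - exact: (measurable_fun_fubini_tonelli_F (m2 := m2) _ mnk).
  - exact: (measurable_fun_fubini_tonelli_F (m2 := m2) _ mnh).
  - by move=> x _; exact: integral_ge0.
  - by move=> x _; exact: integral_ge0.
  - have h1 := Cintegrable_ae1 ih; have h2 := ae_integrable1 inh.
    apply: filterS2 h1 h2 => x ihx inhx _.
    apply: (P2 _ ihx); apply/integrable_nsqP; last exact: inhx.
    exact: (Cmeasurable_comp (measurable_pair1 x) mh).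
have ink : (m1 \x m2)%E.-integrable setT (EFin \o (fun z => nsq (k z))).
  apply/ge0_integrableP; [exact: measurable_nsq|by move=> z; exact: nsq_ge0|].
  by rewrite (fubini_tonelli1 (m1 := m1) (m2 := m2) _ mnk nk0) kN.
(* The order of integration is now reversed, because the second use of Plancherel's identity acts on
   x with eta fixed. *)
transitivity (\int[m2]_eta \int[m1]_xi
    (nsq (ft m1 B1 (fun x => k (x, eta)) xi))%:E)%E.
  under eq_integral => u _ do rewrite (ft_tensor mB1 mB2 u ih).
  rewrite [LHS](fubini_tonelli2 (m1 := m1) (m2 := m2) (fun u : T1 * T2 =>
    (nsq (ft m1 B1 (fun x => k (x, u.2)) u.1))%:E)); first by [].
    2: by move=> u; rewrite lee_fin nsq_ge0.
  apply/measurable_EFinP; apply: measurable_nsq.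
  have mk' : Cmeasurable (fun z : T2 * T1 => k (z.2, z.1)).
    apply: (@Cmeasurable_comp _ _ _ _ _ (fun z : T2 * T1 => (z.2, z.1)) k) => //.
    by apply: measurable_fun_pair; [exact: measurable_snd|exact: measurable_fst].
  have := Cmeasurable_ft2 m1 mB1 mk'.
  move=> /(@Cmeasurable_comp _ _ _ _ _ (fun z : T1 * T2 => (z.2, z.1))).
  by apply; apply: measurable_fun_pair; [exact: measurable_snd|exact: measurable_fst].
rewrite -kN (fubini_tonelli (m1 := m1) (m2 := m2) _ mnk nk0).
apply: ge0_ae_eq_integral; [by []|..].
- have mk' : Cmeasurable (fun z : T2 * T1 => k (z.2, z.1)).
    apply: (@Cmeasurable_comp _ _ _ _ _ (fun z : T2 * T1 => (z.2, z.1)) k) => //.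
    by apply: measurable_fun_pair; [exact: measurable_snd|exact: measurable_fst].
  apply: (measurable_fun_fubini_tonelli_F (m2 := m1) (fun z : T2 * T1 =>
    (nsq (ft m1 B1 (fun x => k (x, z.1)) z.2))%:E)).
    apply/measurable_EFinP; apply: measurable_nsq.
    exact: (Cmeasurable_ft2 m1 mB1 mk').
  by move=> u; rewrite lee_fin nsq_ge0.
- exact: (measurable_fun_fubini_tonelli_G (m1 := m1) _ mnk).
- by move=> eta _; apply: integral_ge0 => xi _; rewrite lee_fin nsq_ge0.
- by move=> eta _; apply: integral_ge0 => xi _; rewrite lee_fin nsq_ge0.
- have := ae_integrable2 ink; apply: filterS => eta inke _.
  apply: (P1 _ (kL1 eta)); apply/integrable_nsqP; last exact: inke.
  exact: (Cmeasurable_comp (measurable_pair2 eta) mk).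
Qed.

End plancherel_tensor.

Section transport.
Context {d1 d2} {T1 : measurableType d1} {T2 : measurableType d2} {R : realType}.
Variable m1 : {sigma_finite_measure set T1 -> \bar R}.
Variable m2 : {sigma_finite_measure set T2 -> \bar R}.
Variables (phi : T1 -> T2).
Variables (B1 : T1 -> T1 -> R) (B2 : T2 -> T2 -> R).
Hypothesis mphi : measurable_fun setT phi.
Hypothesis m2E : forall A, measurable A -> m2 A = m1 (phi @^-1` A).
Hypothesis B2E : forall u v, B2 (phi u) (phi v) = B1 u v.
Hypothesis mB2 : measurable_fun setT (fun z : T2 * T2 => B2 z.1 z.2).

Lemma ge0_integral_transport (f : T2 -> \bar R) : measurable_fun setT f ->
  (forall x, 0 <= f x)%E -> (\int[m2]_x f x = \int[m1]_x f (phi x))%E.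
Proof.
move=> mf f0.
rewrite -(ge0_integral_pushforward mphi m1 (D := setT) (f := f))//.
by apply: eq_measure_integral => A mA _; exact: m2E.
Qed.

Lemma integrable_transport (f : T2 -> \bar R) :
  m2.-integrable setT f -> m1.-integrable setT (f \o phi).
Proof.
move=> /integrableP[mf fi]; apply/integrableP; split.
  exact: measurableT_comp mphi.
have := ge0_integral_transport (f := fun x => `|f x|%E) _ (fun x => abse_ge0 _).
by move=> /= <- //; exact: measurableT_comp mf.
Qed.

Lemma Rintegral_transport (f : T2 -> R) : m2.-integrable setT (EFin \o f) ->
  \int[m2]_x f x = \int[m1]_x f (phi x).
Proof.
move=> intf; congr fine.
have mf : measurable_fun setT (EFin \o f) := measurable_int _ intf.
rewrite -[RHS](integral_pushforward mphi (mu := m1) (D := setT) mf)//.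
  by apply: eq_measure_integral => A mA _; exact: m2E.
exact: integrable_transport.
Qed.

(** The transform and both norms are integrals against the image measure, so they pull back along
    [phi], which respects the pairings. This serves the passage from R x R^n to R^(n+1) through
    [tcons]. *)
Lemma plancherel_transport : plancherel m1 B1 -> plancherel m2 B2.
Proof.
move=> P1 h ih nh; have mh := Cintegrable_Cmeasurable ih.
have ih' : Cintegrable m1 (h \o phi).
  case: ih => ir ii; split.
    exact: (integrable_transport ir).
  exact: (integrable_transport ii).
have trans (k : T2 -> R[i]) : Cmeasurable k ->
    (\int[m2]_x (nsq (k x))%:E = \int[m1]_x (nsq (k (phi x)))%:E)%E.
  move=> mk; apply: (ge0_integral_transport (f := fun x => (nsq (k x))%:E)).
    by apply/measurable_EFinP; exact: measurable_nsq.
  by move=> x; rewrite lee_fin nsq_ge0.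
rewrite (trans _ mh) (trans _ (Cmeasurable_ft m2 mB2 mh)).
transitivity (\int[m1]_x (nsq (ft m1 B1 (h \o phi) x))%:E)%E.
  apply: eq_integral => u _; congr (nsq _)%:E.
  have [ir ii] := Cintegrable_character mB2 (phi u) ih.
  rewrite /ft /Cintegral (Rintegral_transport ir) (Rintegral_transport ii).
  by congr Complex; apply: eq_Rintegral => x _; rewrite /= B2E.
by apply: (P1 _ ih'); rewrite -(trans _ mh).
Qed.

End transport.

(** * Abel means and the Poisson kernel *)

Section shift.
Context {R : realType}.
Local Notation mu := (@lebesgue_measure R).
Local Notation mR := (measurableTypeR R).

Lemma measurable_shift (u : R) :
  measurable_fun [set: mR] ((fun x : R => x + u) : mR -> mR).
Proof. by apply: measurable_funD. Qed.

Lemma lebesgue_measure_shift (u : R) (A : set mR) : measurable A ->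
  mu A = mu ((fun x : R => x + u) @^-1` A).
Proof.
move=> mA.
apply: (@lebesgue_measure_unique R
  (measure_function_pushforward__canonical__measure_function_Measure
    mu (measurable_shift u)) _ _ mA) => _ [[a b]] _ <-.
rewrite /= /pushforward (_ : _ @^-1` _ = `]a - u, b - u]%classic).
  rewrite !lebesgue_measure_itv/= !lte_fin ltrD2r.
  by case: ifPn => // _; rewrite -!EFinB; congr EFin; ring.
by apply/seteqP; split => x /=; rewrite !in_itv/= ltrBlDr lerBrDr.
Qed.

End shift.

Section even_integrals.
Context {R : realType}.
Local Notation mu := (@lebesgue_measure R).

(** Evenness reduces to the half-line, where the fundamental theorem of calculus applies. The
    function [g] is a formula free of |x| that agrees with [f] there, so that [F] can be
    differentiable on the whole line even if [f] is not. *)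
Lemma ge0_even_integral (f g F : R -> R) (l : R) :
  (forall x, 0 <= f x) -> continuous f -> (forall x, f (- x) = f x) ->
  (forall x : R, is_derive x (1 : R) F (g x)) -> (forall x, 0 <= x -> f x = g x) ->
  F x @[x --> +oo] --> l ->
  (\int[mu]_x (f x)%:E = (2 * (l - F 0))%:E)%E.
Proof.
move=> f0 cf evf dF fg Fl.
rewrite ge0_symfun_integralT//; last by move=> x; rewrite /= evf.
rewrite -set_itvcy (ge0_continuous_FTC2y _ _ Fl)//.
- exact: continuous_subspaceT.
- apply: cvg_at_right_filter; apply: differentiable_continuous.
  by apply/derivable1_diffP; have := dF 0 => -[].
- move=> x; rewrite in_itv/= andbT => x0.
  by rewrite derive1E; have [_ ->] := dF x; rewrite fg// ltW.
Qed.

Lemma is_derive_expRM (c x : R) :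
  is_derive x (1 : R) (fun t => expR (- c * t)) (- c * expR (- c * x)).
Proof.
have h := is_derive1_comp (is_derive_expR (- c * x))
  (is_deriveZ (- c) (is_derive_id x 1)).
by apply: (is_derive_eq h); rewrite /= /GRing.scale /= mulr1 mulrC.
Qed.

Lemma is_derive_cosM (b x : R) :
  is_derive x (1 : R) (fun t => cos (b * t)) (- b * sin (b * x)).
Proof.
have h := is_derive1_comp (is_derive_cos (b * x))
  (is_deriveZ b (is_derive_id x 1)).
by apply: (is_derive_eq h); rewrite /= /GRing.scale /= mulr1 mulrC mulrN mulNr.
Qed.

Lemma is_derive_sinM (b x : R) :
  is_derive x (1 : R) (fun t => sin (b * t)) (b * cos (b * x)).
Proof.
have h := is_derive1_comp (is_derive_sin (b * x))
  (is_deriveZ b (is_derive_id x 1)).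
by apply: (is_derive_eq h); rewrite /= /GRing.scale /= mulr1 mulrC.
Qed.

Lemma cvgy_expRM (c : R) : 0 < c -> expR (- c * x) @[x --> +oo] --> 0.
Proof.
move=> c0; under eq_fun do rewrite mulNr.
apply: (cvg_comp (fun x => c * x) (fun x => expR (- x)) _ (@cvgr_expR R)).
by apply: gt0_cvgMry.
Qed.

(** The summand 1 keeps the integrand nonnegative, as [ge0_even_integral] requires; its contribution
    is subtracted again in [Rintegral_abel_cos]. *)
Lemma is_derive_laplace_cos (b c x : R) : 0 < c ->
  is_derive x (1 : R)
    (fun t => expR (- c * t) * (- c^-1 +
       (- (c / (c ^+ 2 + b ^+ 2))) * cos (b * t) + (b / (c ^+ 2 + b ^+ 2)) * sin (b * t)))
    (expR (- c * x) * (1 + cos (b * x))).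
Proof.
move=> c0.
have h := is_deriveM (is_derive_expRM c x) (is_deriveD (is_deriveD (is_derive_cst (- c^-1) x 1)
  (is_deriveZ (- (c / (c ^+ 2 + b ^+ 2))) (is_derive_cosM b x)))
  (is_deriveZ (b / (c ^+ 2 + b ^+ 2)) (is_derive_sinM b x))).
apply: (is_derive_eq h); rewrite /= /GRing.scale /=.
have c2b2 : c ^+ 2 + b ^+ 2 != 0 by rewrite gt_eqF// ltr_pwDl ?exprn_gt0// sqr_ge0.
rewrite !fctE /= /GRing.scale /=; field. by rewrite c2b2 gt_eqF.
Qed.

(** The weight of Abel summation, which increases to 1 as c decreases to 0. *)
Definition abel (c x : R) : R := expR (- c * `|x|).

Lemma abel_gt0 c x : 0 < abel c x. Proof. exact: expR_gt0. Qed.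

Lemma continuous_abel c : continuous (abel c).
Proof.
move=> x; apply: (continuous_comp (f := fun x : R => - c * `|x|) (g := expR)).
  by apply: continuousM; [exact: cst_continuous|exact: norm_continuous].
exact: continuous_expR.
Qed.

Lemma continuous_cosM (b : R) : continuous (fun x : R => cos (b * x)).
Proof.
move=> x; apply: (continuous_comp (f := fun x : R => b * x) (g := cos)).
  by apply: continuousM; [exact: cst_continuous|exact: cvg_id].
exact: continuous_cos.
Qed.

Lemma integral_abel (c : R) : 0 < c ->
  (\int[mu]_x (abel c x)%:E = (2 / c)%:E)%E.
Proof.
move=> c0; have cn0 : c != 0 by rewrite gt_eqF.
have dF (x : R) : is_derive x (1 : R) (fun t => - c^-1 * expR (- c * t))
    (expR (- c * x)).
  have h := is_deriveZ (- c^-1) (is_derive_expRM c x).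
  by apply: (is_derive_eq h); rewrite /GRing.scale /=; field.
have Fl : - c^-1 * expR (- c * x) @[x --> +oo] --> 0.
  rewrite -[X in _ --> X](mulr0 (- c^-1)); apply: cvgM; first exact: cvg_cst.
  exact: cvgy_expRM.
rewrite (ge0_even_integral _ _ _ dF _ Fl).
- by congr EFin; rewrite mulr0 expR0; field.
- by move=> x; exact/ltW/abel_gt0.
- exact: continuous_abel.
- by move=> x; rewrite /abel normrN.
- by move=> x x0; rewrite /abel ger0_norm.
Qed.

Lemma integral_abel_cosD1 (b c : R) : 0 < c ->
  (\int[mu]_x (abel c x * (1 + cos (b * x)))%:E =
   (2 / c + 2 * c / (c ^+ 2 + b ^+ 2))%:E)%E.
Proof.
move=> c0.
have c2b2 : c ^+ 2 + b ^+ 2 != 0 by rewrite gt_eqF// ltr_pwDl ?exprn_gt0// sqr_ge0.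
have dF := fun x => is_derive_laplace_cos b x c0.
set F := (fun t : R => _) in dF.
have Fl : F x @[x --> +oo] --> 0.
  rewrite /F; set A := - c^-1; set B := - (c / _); set D := b / _.
  have bnd x : `|A + B * cos (b * x) + D * sin (b * x)| <= `|A| + `|B| + `|D|.
    rewrite (le_trans (ler_normD _ _))// lerD//.
      rewrite (le_trans (ler_normD _ _))// lerD// normrM ler_piMr//.
      by rewrite ler_norml cos_geN1 cos_le1.
    by rewrite normrM ler_piMr// ler_norml sin_geN1 sin_le1.
  have lim0 : expR (- c * x) * (`|A| + `|B| + `|D|) @[x --> +oo] --> 0.
    rewrite -[X in _ --> X](mul0r (`|A| + `|B| + `|D|)); apply: cvgM.
      exact: cvgy_expRM.
    exact: cvg_cst.
  have limN0 : - (expR (- c * x) * (`|A| + `|B| + `|D|)) @[x --> +oo] --> 0.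
    by rewrite -[X in _ --> X]oppr0; apply: cvgN.
  apply: (squeeze_cvgr _ limN0 lim0).
  near=> x; rewrite -ler_norml normrM (ger0_norm (expR_ge0 _)).
  by rewrite ler_wpM2l// expR_ge0.
rewrite (ge0_even_integral _ _ _ dF _ Fl).
- congr EFin; rewrite /F !mulr0 expR0 cos0 sin0; field.
  by rewrite c2b2 gt_eqF.
- move=> x; apply: mulr_ge0; first exact/ltW/abel_gt0.
  by rewrite -lerBlDl sub0r cos_geN1.
- move=> x; apply: continuousM; first exact: continuous_abel.
  by apply: continuousD; [exact: cst_continuous|exact: continuous_cosM].
- by move=> x; rewrite /abel normrN mulrN cosN.
- by move=> x x0; rewrite /abel ger0_norm.
Unshelve. all: by end_near. Qed.

Lemma integrable_abel (c : R) : 0 < c -> mu.-integrable setT (EFin \o abel c).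
Proof.
move=> c0; apply/ge0_integrableP.
- exact: continuous_measurable_fun (@continuous_abel c).
- by move=> x; exact/ltW/abel_gt0.
- by rewrite integral_abel// ltry.
Qed.

Lemma Rintegral_abel_cos (b c : R) : 0 < c ->
  \int[mu]_x (abel c x * cos (b * x)) = 2 * c / (c ^+ 2 + b ^+ 2).
Proof.
move=> c0.
have i1 : mu.-integrable setT (EFin \o (fun x => abel c x * (1 + cos (b * x)))).
  apply/ge0_integrableP.
  - apply: continuous_measurable_fun => x; apply: continuousM.
      exact: continuous_abel.
    by apply: continuousD; [exact: cst_continuous|exact: continuous_cosM].
  - move=> x; apply: mulr_ge0; first exact/ltW/abel_gt0.
    by rewrite -lerBlDl sub0r cos_geN1.
  - by rewrite integral_abel_cosD1// ltry.
rewrite (_ : \int[mu]_x _ =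
    \int[mu]_x (abel c x * (1 + cos (b * x)) - abel c x)); last first.
  by apply: eq_Rintegral => x _; ring.
rewrite RintegralB//; last exact: integrable_abel.
by rewrite /Rintegral integral_abel_cosD1// integral_abel//=; ring.
Qed.

(* The cosine transform of [abel c] at frequency 2 pi u. *)
Definition poisson (c u : R) : R := 2 * c / (c ^+ 2 + (2 * pi * u) ^+ 2).

Lemma poisson_den_gt0 (c u : R) : 0 < c -> 0 < c ^+ 2 + (2 * pi * u) ^+ 2.
Proof. by move=> c0; rewrite ltr_pwDl ?exprn_gt0// sqr_ge0. Qed.

Lemma poisson_ge0 (c u : R) : 0 < c -> 0 <= poisson c u.
Proof. by move=> c0; rewrite ltW// divr_gt0 ?poisson_den_gt0// mulr_gt0. Qed.

Lemma poissonN (c u : R) : poisson c (- u) = poisson c u.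
Proof. by rewrite /poisson mulrN sqrrN. Qed.

Lemma continuous_poisson (c : R) : 0 < c -> continuous (poisson c).
Proof.
move=> c0 x.
have h : 2 * pi * u @[u --> x] --> (2 * pi * x : R).
  by apply: cvgM; [exact: cvg_cst|exact: cvg_id].
apply: (@cvgM _ _ _ _ (fun=> 2 * c) (fun u => (c ^+ 2 + (2 * pi * u) ^+ 2)^-1)).
  exact: cvg_cst.
apply: cvgV; first by rewrite gt_eqF// poisson_den_gt0.
apply: cvgD; first exact: cvg_cst.
exact: (cvgM h h).
Qed.

Lemma integral_poisson (c : R) : 0 < c -> (\int[mu]_x (poisson c x)%:E = 1)%E.
Proof.
move=> c0; have pi0 : (pi : R) != 0 by rewrite gt_eqF// pi_gt0.
have dF (x : R) : is_derive x (1 : R) (fun x => pi^-1 * atan (2 * pi / c * x))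
    (poisson c x).
  have h1 := is_derive1_comp (is_derive1_atan (2 * pi / c * x))
    (is_deriveZ (2 * pi / c) (is_derive_id x 1)).
  have h := is_deriveZ (pi^-1 : R) h1.
  apply: (is_derive_eq h); rewrite /GRing.scale /= /poisson.
  have := poisson_den_gt0 x c0 => /lt0r_neq0 den.
  move: (pi : R) pi0 den => p p0 den.
  by field; rewrite den p0 gt_eqF.
have Fl : pi^-1 * atan (2 * pi / c * x) @[x --> +oo] --> (2^-1 : R).
  rewrite (_ : 2^-1 = pi^-1 * (pi / 2)); last by rewrite mulrA mulVf// mul1r.
  apply: cvgM; first exact: cvg_cst.
  apply: (cvg_comp (fun x : R => 2 * pi / c * x) (@atan R) _ (@cvgy_atan R)).
  by apply: gt0_cvgMry => //; rewrite divr_gt0// mulr_gt0// pi_gt0.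
rewrite (ge0_even_integral _ _ _ dF _ Fl).
- by rewrite mulr0 atan0 mulr0 subr0 mulfV.
- by move=> x; exact: poisson_ge0.
- exact: continuous_poisson.
- exact: poissonN.
- by [].
Qed.

(** Away from the origin the kernel is O(c), with a fixed integrable majorant; the tail of an
    integral against it is therefore O(c) as well. The constant comes from 1 + v^2 <= (1 + D^-2)
    (c^2 + v^2) for v^2 >= D^2. *)
Lemma poisson_tail (c d u : R) : 0 < c -> 0 < d -> d <= `|u| ->
  poisson c u <= c * (1 + (2 * pi * d) ^- 2) * poisson 1 u.
Proof.
move=> c0 d0 du; rewrite /poisson expr1n mulr1.
have pi0 : 0 < (pi : R) by exact: pi_gt0.
set D := 2 * pi * d; set v := 2 * pi * u.
have D0 : 0 < D by rewrite !mulr_gt0.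
have Dv : D ^+ 2 <= v ^+ 2.
  rewrite -(real_normK (num_real v)) ler_pXn2r ?nnegrE ?normr_ge0 ?(ltW D0)//.
  by rewrite /v normrM gtr0_norm ?mulr_gt0// ler_pM2l// mulr_gt0.
have v1 : 0 < 1 + v ^+ 2 by rewrite ltr_pwDl// sqr_ge0.
have key : 1 + v ^+ 2 <= (1 + D ^- 2) * (c ^+ 2 + v ^+ 2).
  rewrite mulrDl mul1r mulrDr -/(D ^- 2).
  have : 1 <= D ^- 2 * v ^+ 2 by rewrite mulrC ler_pdivlMr ?exprn_gt0// mul1r.
  have : 0 <= D ^- 2 * c ^+ 2 by rewrite mulr_ge0// ?invr_ge0 ?sqr_ge0.
  have := sqr_ge0 c; lra.
rewrite ler_pdivrMr; last exact: poisson_den_gt0.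
apply: (@le_trans _ _ (2 * c * ((1 + D ^- 2) * (c ^+ 2 + v ^+ 2) / (1 + v ^+ 2)))).
  by rewrite ler_peMr ?mulr_ge0 ?(ltW c0)// ler_pdivlMr// mul1r.
by rewrite le_eqVlt; apply/orP; left; apply/eqP; ring.
Qed.

End even_integrals.

(** * Tonelli and Fubini for real-valued functions on products *)

Section product.
Context {d1 d2} {T1 : measurableType d1} {T2 : measurableType d2} {R : realType}.
Variable m1 : {sigma_finite_measure set T1 -> \bar R}.
Variable m2 : {sigma_finite_measure set T2 -> \bar R}.

Lemma sf_tonelli1 (f : T1 * T2 -> R) : measurable_fun setT f ->
  (forall z, 0 <= f z) ->
  (\int[sfprod m1 m2]_z (f z)%:E = \int[m1]_x \int[m2]_y (f (x, y))%:E)%E.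
Proof.
move=> mf f0.
apply: (fubini_tonelli1 (m1 := m1) (m2 := m2) (fun z => (f z)%:E)).
  exact/measurable_EFinP.
by move=> z; rewrite lee_fin.
Qed.

Lemma sf_tonelli2 (f : T1 * T2 -> R) : measurable_fun setT f ->
  (forall z, 0 <= f z) ->
  (\int[sfprod m1 m2]_z (f z)%:E = \int[m2]_y \int[m1]_x (f (x, y))%:E)%E.
Proof.
move=> mf f0.
apply: (fubini_tonelli2 (m1 := m1) (m2 := m2) (fun z => (f z)%:E)).
  exact/measurable_EFinP.
by move=> z; rewrite lee_fin.
Qed.

Lemma sf_tonelli (f : T1 * T2 -> R) : measurable_fun setT f ->
  (forall z, 0 <= f z) ->
  (\int[m1]_x \int[m2]_y (f (x, y))%:E = \int[m2]_y \int[m1]_x (f (x, y))%:E)%E.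
Proof. by move=> mf f0; rewrite -sf_tonelli1// sf_tonelli2. Qed.

Lemma sf_measurable1 (f : T1 * T2 -> R) : measurable_fun setT f ->
  (forall z, 0 <= f z) ->
  measurable_fun setT (fun x => \int[m2]_y (f (x, y))%:E)%E.
Proof.
move=> mf f0.
apply: (measurable_fun_fubini_tonelli_F (m2 := m2) (fun z => (f z)%:E)).
  exact/measurable_EFinP.
by move=> z; rewrite lee_fin.
Qed.

Lemma sf_Rfubini1 (f : T1 * T2 -> R) :
  (sfprod m1 m2).-integrable setT (EFin \o f) ->
  \int[sfprod m1 m2]_z f z = \int[m1]_x \int[m2]_y f (x, y).
Proof. by move=> intf; exact: (Rfubini intf). Qed.

Lemma integrable_tensor (f : T1 -> R) (g : T2 -> R) :
  m1.-integrable setT (EFin \o f) -> m2.-integrable setT (EFin \o g) ->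
  (sfprod m1 m2).-integrable setT (EFin \o (fun z => f z.1 * g z.2)).
Proof.
move=> intf intg.
have mf : measurable_fun setT f by exact/measurable_EFinP/(measurable_int _ intf).
have mg : measurable_fun setT g by exact/measurable_EFinP/(measurable_int _ intg).
have mfg : measurable_fun setT (fun z : T1 * T2 => f z.1 * g z.2).
  apply: measurable_funM.
    exact: (measurableT_comp mf measurable_fst).
  exact: (measurableT_comp mg measurable_snd).
apply/integrableP; split; first exact/measurable_EFinP.
under eq_integral do rewrite /= normrM.
rewrite (sf_tonelli1 (f := fun z => `|f z.1| * `|g z.2|)); last 2 first.
- apply: measurable_funM; apply: measurableT_comp => //.
    exact: (measurableT_comp mf measurable_fst).
  exact: (measurableT_comp mg measurable_snd).
- by move=> z; rewrite mulr_ge0.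
have gfin : (\int[m2]_y `|(g y)%:E| < +oo)%E by have /integrableP[_] := intg.
have ffin : (\int[m1]_y `|(f y)%:E| < +oo)%E by have /integrableP[_] := intf.
rewrite (eq_integral (fun x => `|(f x)%:E| * \int[m2]_y `|(g y)%:E|)%E); last first.
  move=> x _ /=; rewrite -ge0_integralZl//.
  by apply/measurable_EFinP; exact: measurableT_comp.
rewrite ge0_integralZr//; last first.
- exact: integral_ge0.
- by apply/measurable_EFinP; exact: measurableT_comp.
rewrite lte_mul_pinfty//.
- exact: integral_ge0.
- by rewrite ge0_fin_numE//; exact: integral_ge0.
Qed.

Lemma Rintegral_tensor (f : T1 -> R) (g : T2 -> R) :
  m1.-integrable setT (EFin \o f) -> m2.-integrable setT (EFin \o g) ->
  \int[sfprod m1 m2]_z (f z.1 * g z.2) = (\int[m1]_x f x) * (\int[m2]_y g y).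
Proof.
move=> intf intg; rewrite (sf_Rfubini1 (integrable_tensor intf intg)) /=.
rewrite -RintegralZr//; apply: eq_Rintegral => x _.
by rewrite RintegralZl.
Qed.

End product.

Section swap.
Context {d1 d2} {T1 : measurableType d1} {T2 : measurableType d2} {R : realType}.
Variable m1 : {sigma_finite_measure set T1 -> \bar R}.
Variable m2 : {sigma_finite_measure set T2 -> \bar R}.

Lemma sf_Rfubini2 (f : T1 * T2 -> R) :
  (sfprod m1 m2).-integrable setT (EFin \o f) ->
  \int[sfprod m1 m2]_z f z = \int[m2]_y \int[m1]_x f (x, y).
Proof.
move=> intf; have mf := measurable_int _ intf; congr fine.
rewrite -[LHS](integral21_prod_meas1 (m1 := m1) (m2 := m2) intf).
apply: ae_eq_integral; [by []|exact: (measurable_fubini_G (m1 := m1) intf)|..].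
- apply/measurable_EFinP.
  apply: (measurable_Rintegral m1 (f := fun z : T2 * T1 => f (z.2, z.1))).
  have /measurable_EFinP mf' := mf.
  apply: (measurableT_comp mf').
  by apply: measurable_fun_pair; [exact: measurable_snd|exact: measurable_fst].
- have := ae_integrable2 (m1 := m1) (m2 := m2) intf; apply: filterS => y /= iy _.
  by rewrite /Rintegral fineK//; exact: integrable_fin_num.
Qed.

End swap.

Section nsq_Cintegral.
Context {d} {T : measurableType d} {R : realType}.
Variable m : {sigma_finite_measure set T -> \bar R}.

(** The integrand is the real part of h(x) times the conjugate of h(y): a squared modulus of an
    integral becomes a double integral, ready for Fubini. *)
Lemma nsq_Cintegral (h : T -> R[i]) : Cintegrable m h ->
  nsq (Cintegral m h) = \int[sfprod m m]_z
    (complex.Re (h z.1) * complex.Re (h z.2) + complex.Im (h z.1) * complex.Im (h z.2)).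
Proof.
move=> [ir ii]; rewrite RintegralD//.
- rewrite (Rintegral_tensor (m1 := m) (m2 := m) ir ir).
  by rewrite (Rintegral_tensor (m1 := m) (m2 := m) ii ii) /nsq !expr2.
- exact: (integrable_tensor ir ir).
- exact: (integrable_tensor ii ii).
Qed.

End nsq_Cintegral.

(** * Abel means of the squared transform *)

Section abel_regularisation.
Context {R : realType}.
Local Notation mu := (@lebesgue_measure R).
Local Notation mR := (measurableTypeR R).
Local Notation mu2 := (sfprod (@lebesgue_measure R) (@lebesgue_measure R)).
Local Notation ftR := (ft (@lebesgue_measure R) (fun x y : mR => (x : R) * y)).

Lemma measurable_mulR : measurable_fun setT (fun z : mR * mR => (z.1 : R) * z.2).
Proof. by apply: measurable_funM; [exact: measurable_fst|exact: measurable_snd]. Qed.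

Lemma ge0_integral_shift (f : mR -> R) (u : R) : measurable_fun setT f ->
  (forall x, 0 <= f x) ->
  (\int[mu]_x (f (x + u))%:E = \int[mu]_x (f x)%:E)%E.
Proof.
move=> mf f0; apply/esym.
apply: (ge0_integral_transport (m1 := mu) (m2 := mu) (measurable_shift u)
  (lebesgue_measure_shift u) (f := fun x => (f x)%:E)).
  exact/measurable_EFinP.
by move=> x; rewrite lee_fin.
Qed.

Variable a : mR -> R.
Hypothesis ia : mu.-integrable setT (EFin \o a).

Let ma : measurable_fun setT a.
Proof. by have /integrableP[/measurable_EFinP] := ia. Qed.

Let ma1 : measurable_fun setT (fun z : mR * mR => a z.1).
Proof. exact: (measurableT_comp ma measurable_fst). Qed.

Let ma2 : measurable_fun setT (fun z : mR * mR => a z.2).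
Proof. exact: (measurableT_comp ma measurable_snd). Qed.

Lemma Cintegrable_realC : Cintegrable mu (fun x => (a x)%:C%C).
Proof. by split => //=; exact: integrable0. Qed.

Lemma nsq_ft_real (q : mR) : nsq (ftR (fun x => (a x)%:C%C) q) =
  \int[mu2]_z (a z.1 * a z.2 * cos (2 * pi * ((z.1 : R) - z.2) * q)).
Proof.
rewrite /ft nsq_Cintegral; last first.
  apply: (Cintegrable_character measurable_mulR).
  exact: Cintegrable_realC.
apply: eq_Rintegral => -[x y] _ /=.
rewrite !mul0r !subr0 !addr0.
rewrite !cosN !sinN.
rewrite (_ : 2 * pi * (x - y) * q = 2 * pi * (q * x) - 2 * pi * (q * y)); last by ring.
rewrite cosB; ring.
Qed.

Let measurable_cos2 : measurable_fun setT
  (fun w : mR * (mR * mR) => cos (2 * pi * ((w.2.1 : R) - w.2.2) * w.1)).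
Proof.
apply: measurableT_comp; first exact: continuous_measurable_fun (@continuous_cos R).
apply: measurable_funM; last exact: measurable_fst.
apply: measurable_funM; first exact: measurable_cst.
apply: measurable_funB.
  exact: (measurableT_comp measurable_fst measurable_snd).
exact: (measurableT_comp measurable_snd measurable_snd).
Qed.

Let measurable_aa : measurable_fun setT (fun z : mR * mR => a z.1 * a z.2).
Proof. exact: measurable_funM. Qed.

Let integrable_aa : mu2.-integrable setT (EFin \o (fun z => a z.1 * a z.2)).
Proof. exact: (integrable_tensor ia ia). Qed.

Variable c : R.
Hypothesis c0 : 0 < c.

Let G (w : mR * (mR * mR)) : R :=
  abel c w.1 * (a w.2.1 * a w.2.2 * cos (2 * pi * ((w.2.1 : R) - w.2.2) * w.1)).

Let mG : measurable_fun setT G.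
Proof.
apply: measurable_funM.
  apply: (measurableT_comp (f := abel c)).
    exact: continuous_measurable_fun (@continuous_abel R c).
  exact: measurable_fst.
apply: measurable_funM => //.
exact: (measurableT_comp measurable_aa measurable_snd).
Qed.

Let iG : (sfprod mu mu2).-integrable setT (EFin \o G).
Proof.
have := integrable_tensor (integrable_abel c0) (integrable_norm integrable_aa).
apply: le_integrable => //; first exact/measurable_EFinP.
move=> w _; rewrite /= lee_fin /G !normrM !normr_id.
rewrite [leLHS]mulrA ler_piMr ?mulr_ge0//.
by rewrite ler_norml cos_geN1 cos_le1.
Qed.

Let inner_integrable (q : mR) : mu2.-integrable setT (EFin \o
  (fun z => a z.1 * a z.2 * cos (2 * pi * ((z.1 : R) - z.2) * q))).
Proof.
apply: le_integrable integrable_aa => //.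
  apply/measurable_EFinP; apply: measurable_funM => //.
  exact: (measurableT_comp measurable_cos2 (measurable_pair1 q)).
move=> z _; rewrite /= lee_fin normrM ler_piMr//.
by rewrite ler_norml cos_geN1 cos_le1.
Qed.

Let innerE (q : mR) : \int[mu2]_z G (q, z) =
  abel c q * nsq (ftR (fun x => (a x)%:C%C) q).
Proof. by rewrite nsq_ft_real -RintegralZl; [|by []|exact: inner_integrable]. Qed.

Lemma integrable_abel_ft :
  mu.-integrable setT (EFin \o (fun q => abel c q * nsq (ftR (fun x => (a x)%:C%C) q))).
Proof.
apply: eq_integrable (integrable_fubini_F (m1 := mu) (m2 := mu2) iG) => // q _.
rewrite /= -innerE /fubini_F /Rintegral fineK//.
apply: integrable_fin_num => //.
apply: eq_integrable (integrableZl measurableT (abel c q) (inner_integrable q)) => //.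
Qed.

(** The Abel weight makes the triple integral over q, x and y absolutely convergent. Integrating
    first in q produces the cosine transform of the weight at x - y, which is the Poisson kernel. *)
Lemma Rintegral_abel_ft :
  \int[mu]_q (abel c q * nsq (ftR (fun x => (a x)%:C%C) q)) =
  \int[mu2]_z (a z.1 * a z.2 * poisson c ((z.1 : R) - z.2)).
Proof.
transitivity (\int[sfprod mu mu2]_w G w).
  rewrite (sf_Rfubini1 (m1 := mu) (m2 := mu2) iG).
  by apply: eq_Rintegral => q _; rewrite innerE.
rewrite (sf_Rfubini2 (m1 := mu) (m2 := mu2) iG).
apply: eq_Rintegral => -[x y] _ /=.
rewrite /poisson -(Rintegral_abel_cos (2 * pi * (x - y)) c0) -RintegralZl//; last first.
  apply: le_integrable (integrable_abel c0) => //.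
    apply/measurable_EFinP; apply: measurable_funM.
      exact: continuous_measurable_fun (@continuous_abel R c).
    exact: continuous_measurable_fun (@continuous_cosM R _).
  move=> q _; rewrite /= lee_fin normrM ler_piMr//.
  by rewrite ler_norml cos_geN1 cos_le1.
by apply: eq_Rintegral => q _; rewrite /G /=; ring.
Qed.

Hypothesis ia2 : mu.-integrable setT (EFin \o (fun x => a x ^+ 2)).

Let mK : measurable_fun setT (fun z : mR * mR => poisson c ((z.1 : R) - z.2)).
Proof.
apply: (measurableT_comp (f := poisson c)).
  exact: continuous_measurable_fun (@continuous_poisson R c c0).
by apply: measurable_funB; [exact: measurable_fst|exact: measurable_snd].
Qed.

Let mP : measurable_fun setT (poisson c : mR -> R).
Proof. exact: continuous_measurable_fun (@continuous_poisson R c c0). Qed.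

Let integral_sqK1 :
  (\int[mu2]_z (a z.1 ^+ 2 * poisson c ((z.1 : R) - z.2))%:E =
   \int[mu]_x (a x ^+ 2)%:E)%E.
Proof.
rewrite sf_tonelli1; last 2 first.
- by apply: measurable_funM => //; exact: measurable_funX.
- by move=> z; rewrite mulr_ge0 ?sqr_ge0 ?poisson_ge0.
apply: eq_integral => x _ /=.
under eq_integral do rewrite EFinM.
rewrite ge0_integralZl//; last 3 first.
- apply/measurable_EFinP; exact: (measurableT_comp mK (measurable_pair1 x)).
- by move=> y _; rewrite lee_fin poisson_ge0.
- by rewrite lee_fin sqr_ge0.
rewrite (eq_integral (fun y : mR => (poisson c ((y : R) + - (x : R)))%:E)); last first.
  by move=> y _; rewrite -poissonN opprB.
rewrite ge0_integral_shift//; last by move=> y; exact: poisson_ge0.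
by rewrite integral_poisson// mule1.
Qed.

Let integral_sqK2 :
  (\int[mu2]_z (a z.2 ^+ 2 * poisson c ((z.1 : R) - z.2))%:E =
   \int[mu]_x (a x ^+ 2)%:E)%E.
Proof.
rewrite sf_tonelli2; last 2 first.
- by apply: measurable_funM => //; exact: measurable_funX.
- by move=> z; rewrite mulr_ge0 ?sqr_ge0 ?poisson_ge0.
apply: eq_integral => x _ /=.
under eq_integral do rewrite EFinM.
rewrite ge0_integralZl//; last 3 first.
- apply/measurable_EFinP; exact: (measurableT_comp mK (measurable_pair2 x)).
- by move=> y _; rewrite lee_fin poisson_ge0.
- by rewrite lee_fin sqr_ge0.
rewrite ge0_integral_shift//; last by move=> y; exact: poisson_ge0.
by rewrite integral_poisson// mule1.
Qed.

Let sq_fin : (\int[mu]_x (a x ^+ 2)%:E < +oo)%E.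
Proof.
apply/(ge0_integrableP mu (f := fun x => a x ^+ 2)) => //.
  exact: measurable_funX.
by move=> x; exact: sqr_ge0.
Qed.

Let iK1 : mu2.-integrable setT
  (EFin \o (fun z => a z.1 ^+ 2 * poisson c ((z.1 : R) - z.2))).
Proof.
apply/ge0_integrableP.
- by apply: measurable_funM => //; exact: measurable_funX.
- by move=> z; rewrite mulr_ge0 ?sqr_ge0 ?poisson_ge0.
- by rewrite integral_sqK1.
Qed.

Let iK2 : mu2.-integrable setT
  (EFin \o (fun z => a z.2 ^+ 2 * poisson c ((z.1 : R) - z.2))).
Proof.
apply/ge0_integrableP.
- by apply: measurable_funM => //; exact: measurable_funX.
- by move=> z; rewrite mulr_ge0 ?sqr_ge0 ?poisson_ge0.
- by rewrite integral_sqK2.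
Qed.

Let iK12 : mu2.-integrable setT
  (EFin \o (fun z => a z.1 * a z.2 * poisson c ((z.1 : R) - z.2))).
Proof.
apply: le_integrable (integrableD measurableT iK1 iK2) => //.
  by apply/measurable_EFinP; exact: measurable_funM.
move=> z _; rewrite /= lee_fin -mulrDl !normrM ler_wpM2r//.
rewrite -normrM (ger0_norm (addr_ge0 _ _)) ?sqr_ge0//.
rewrite ler_norml.
have := sqr_ge0 (a z.1 - a z.2); have := sqr_ge0 (a z.1 + a z.2).
rewrite !sqrrD sqrrN mulrN; have := sqr_ge0 (a z.1); have := sqr_ge0 (a z.2).
by move=> ? ? ? ?; apply/andP; split; lra.
Qed.

(* 2 a(x) a(y) = a(x)^2 + a(y)^2 - (a(x) - a(y))^2 and the kernel has mass 1. *)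
Lemma Rintegral_abel_ftE :
  \int[mu]_q (abel c q * nsq (ftR (fun x => (a x)%:C%C) q)) =
  \int[mu]_x (a x ^+ 2) - 2^-1 *
  \int[mu2]_z ((a z.1 - a z.2) ^+ 2 * poisson c ((z.1 : R) - z.2)).
Proof.
rewrite Rintegral_abel_ft.
have -> : \int[mu2]_z ((a z.1 - a z.2) ^+ 2 * poisson c ((z.1 : R) - z.2)) =
    \int[mu2]_z ((a z.1 ^+ 2 * poisson c ((z.1 : R) - z.2) +
      a z.2 ^+ 2 * poisson c ((z.1 : R) - z.2)) -
      2 * (a z.1 * a z.2 * poisson c ((z.1 : R) - z.2))).
  by apply: eq_Rintegral => z _; ring.
have iD : mu2.-integrable setT (EFin \o (fun z =>
    a z.1 ^+ 2 * poisson c ((z.1 : R) - z.2) +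
    a z.2 ^+ 2 * poisson c ((z.1 : R) - z.2))).
  by apply: eq_integrable (integrableD measurableT iK1 iK2).
have iZ : mu2.-integrable setT (EFin \o (fun z =>
    2 * (a z.1 * a z.2 * poisson c ((z.1 : R) - z.2)))).
  by apply: eq_integrable (integrableZl measurableT 2 iK12).
rewrite RintegralB// RintegralD// RintegralZl//.
have -> : \int[mu2]_z (a z.1 ^+ 2 * poisson c ((z.1 : R) - z.2)) =
    \int[mu]_x (a x ^+ 2) by congr fine; exact: integral_sqK1.
have -> : \int[mu2]_z (a z.2 ^+ 2 * poisson c ((z.1 : R) - z.2)) =
    \int[mu]_x (a x ^+ 2) by congr fine; exact: integral_sqK2.
by field.
Qed.

End abel_regularisation.

(** * Continuity of translations in L^2 *)

Lemma cvge0_near_lt {R : realType} (u : nat -> \bar R) (e : R) :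
  u @ \oo --> 0%E -> 0 < e -> \forall n \near \oo, (u n < e%:E)%E.
Proof.
move=> u0 e0; apply: (u0 [set x | (x < e%:E)%E]).
apply: open_nbhs_nbhs; split; first exact: open_ereal_lt_ereal.
by rewrite /= lte_fin.
Qed.

Section truncation.
Context {d} {T : measurableType d} {R : realType}.
Variable mu : {measure set T -> \bar R}.

(** Dominated convergence. The sets have to exhaust only the points where [F] is nonzero, since in
    [L2_truncation] they are level sets that never contain the zeros of the function. *)
Lemma cvg_integral_setC (F : T -> R) (S : nat -> set T) :
  mu.-integrable setT (EFin \o F) -> (forall x, 0 <= F x) ->
  (forall n, measurable (S n)) ->
  (forall x, F x != 0 -> \forall n \near \oo, S n x) ->
  (fun n => \int[mu]_x (F x * \1_(~` S n) x)%:E)%E @ \oo --> 0%E.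
Proof.
move=> iF F0 mS FS.
have mF : measurable_fun setT F by have /integrableP[/measurable_EFinP] := iF.
have [||||_ _] := @dominated_convergence _ _ _ mu setT measurableT
  (fun n x => (F x * \1_(~` S n) x)%:E) (cst 0%E) (EFin \o F) _ _ _ iF _.
- move=> n; apply/measurable_EFinP; apply: measurable_funM => //.
  by apply: measurable_indic; exact: measurableC.
- exact: measurable_cst.
- apply: aeW => x _; have [Fx0|Fx0] := eqVneq (F x) 0.
    by under eq_fun do rewrite Fx0 mul0r; exact: cvg_cst.
  apply: cvg_near_cst; have := FS x Fx0; apply: filterS => n Snx.
  by rewrite indicE memNset ?mulr0//=; apply.
- apply: aeW => x n _; rewrite lee_fin normrM (ger0_norm (F0 x)) ler_piMr//.
  by rewrite indicE; case: (_ \in _); rewrite ?normr1 ?normr0.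
by rewrite integral0.
Qed.

End truncation.

Section translation.
Context {R : realType}.
Local Notation mu := (@lebesgue_measure R).
Local Notation mR := (measurableTypeR R).

(** The map (y, u) |-> g(y + u) - g(y) is continuous and vanishes at u = 0; compactness of [E] makes
    the resulting neighbourhoods of 0 uniform in y. *)
Lemma compact_shift_near (g : R -> R) (E : set R) (delta : R) :
  compact E -> continuous g -> 0 < delta ->
  \forall u \near (0 : R), forall y, E y -> `|g (y + u) - g y| <= delta.
Proof.
move=> cE cg d0.
move/compact_near_coveringP : cE.
move=> /(_ R (nbhs (0 : R)) (fun u y => `|g (y + u) - g y| <= delta)).
apply => x Ex.
pose h (z : R * R) := g (z.1 + z.2) - g z.1.
have hx : h (x, 0) = 0 by rewrite /h /= addr0 subrr.
have ch : h z @[z --> (x, 0 : R)] --> (0 : R).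
  rewrite -[X in _ --> X]hx /h; apply: cvgB.
    apply: (@cvg_comp _ _ _ (fun z : R * R => z.1 + z.2) g _ (nbhs (x + 0))).
      have c2 : snd z @[z --> (x, 0 : R)] --> (0 : R) by exact: cvg_snd.
      have c1 : fst z @[z --> (x, 0 : R)] --> x by exact: cvg_fst.
      exact: (cvgD c1 c2).
    exact: cg.
  by apply: (@cvg_comp _ _ _ fst g _ (nbhs x)); [exact: cvg_fst|exact: cg].
move/cvgrPdist_le : ch => /(_ delta d0).
by apply: filterS => -[y u] /=; rewrite sub0r normrN.
Qed.

Lemma itvcc_normE (M x : R) : (x \in `[- M, M]) = (`|x| <= M).
Proof. by rewrite in_itv/= ler_norml. Qed.

Lemma measurable_norm_le (M : R) : measurable [set x : mR | `|x : R| <= M].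
Proof.
rewrite (_ : [set _ | _] = [set` `[- M, M]]); first exact: measurable_itv.
by apply/seteqP; split => x /=; rewrite itvcc_normE.
Qed.

(* On the bounded functions b with bounded support, |b(y+u) - b(y)|^2 is at
   most 2 M |b(y+u) - b(y)|, so that it is enough to work in L^1. *)
Lemma translation_bounded (b : mR -> R) (M e : R) : measurable_fun setT b ->
  0 < M -> (forall x, `|b x| <= M) -> (forall x : R, M < `|x| -> b x = 0) -> 0 < e ->
  \forall u \near (0 : R),
    (\int[mu]_y ((b ((y : R) + u) - b y) ^+ 2)%:E <= e%:E)%E.
Proof.
move=> mb M0 bM bsupp e0.
(* For |u| <= 1, b and its translate by u both vanish outside [J], while [E] leaves room for y + u
   with y in [J]. *)
set E := [set` `[- (M + 2), M + 2]]; set J := [set` `[- (M + 1), M + 1]].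
have mE : measurable (E : set mR) by exact: measurable_itv.
have mJ : measurable (J : set mR) by exact: measurable_itv.
have muJ : mu J = (2 * (M + 1))%:E.
  rewrite /J lebesgue_measure_itv/= lte_fin ltrNl.
  rewrite ifT; last by lra.
  by rewrite -EFinB; congr EFin; ring.
have muE : (mu E < +oo)%E.
  by rewrite /E lebesgue_measure_itv/=; case: ifP => // _; rewrite -EFinB ltry.
have ib : mu.-integrable E (EFin \o b).
  apply: measurable_bounded_integrable => //; first exact: measurable_funTS.
  exists M; split; first exact: num_real.
  by move=> x Mx y _ /=; rewrite (le_trans (bM y))// ltW.
(* The final bound is 2 M (e1 + e1 + delta * 2 (M + 1)), where 2 (M + 1) is the length of [J]; these
   choices make it equal to e. *)
pose e1 := e / (8 * M); pose delta := e / (8 * M * (M + 1)).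
have e10 : 0 < e1 by rewrite divr_gt0// mulr_gt0.
have delta0 : 0 < delta by rewrite divr_gt0// !mulr_gt0// addr_gt0.
have [g_ [cg_ _ gb]] := approximation_continuous_integrable mE muE ib.
have [g [cg gb1]] : exists g : R -> R, continuous g /\
    (\int[mu]_(z in E) `|(b z - g z)%:E| <= e1%:E)%E.
  have : \forall n \near \oo, (\int[mu]_(z in E) `|(b z - g_ n z)%:E| < e1%:E)%E.
    exact: cvge0_near_lt gb e10.
  by move=> [n _ /(_ n (leqnn n))] /ltW bgn; exists (g_ n).
have mg : measurable_fun setT (g : mR -> R) by exact: continuous_measurable_fun.
have cE : compact E by exact: segment_compact.
pose w (y : mR) := `|b y - g y| * \1_E y.
have mw : measurable_fun setT w.
  apply: measurable_funM; last exact: measurable_indic.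
  by apply: measurableT_comp => //; exact: measurable_funB.
have w0 y : 0 <= w y by rewrite mulr_ge0// indicE ler0n.
have wE : (\int[mu]_y (w y)%:E <= e1%:E)%E.
  apply: le_trans gb1; rewrite [leRHS]integral_mkcond le_eqVlt; apply/orP; left.
  apply/eqP/eq_integral => y _; rewrite patchE /w indicE.
  by case: (y \in E); rewrite ?mulr1 ?mulr0.
have J0 y : 0 <= delta * \1_J y by rewrite mulr_ge0 ?(ltW delta0)// indicE ler0n.
have n1 : \forall u \near (0 : R), `|u| <= 1 by exact: (@nbhs0_le R R).
have n2 := compact_shift_near cE cg delta0.
apply: filterS2 n1 n2 => u u1 ug.
have mwu : measurable_fun setT (fun y : mR => w ((y : R) + u)).
  exact: (measurableT_comp mw (measurable_shift u)).
have mbu : measurable_fun setT (fun y : mR => b ((y : R) + u)).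
  exact: (measurableT_comp mb (measurable_shift u)).
have pw (y : mR) : (b ((y : R) + u) - b y) ^+ 2 <=
    2 * M * ((w ((y : R) + u) + w y) + delta * \1_J y).
  have b2M : `|b ((y : R) + u) - b y| <= 2 * M.
    by rewrite (le_trans (ler_normB _ _))// mulr_natl mulr2n lerD.
  rewrite -real_normK ?num_real// expr2.
  have yM : `|(y : R) + u| <= `|y : R| + 1 by rewrite (le_trans (ler_normD _ _))// lerD2l.
  have yM' : `|y : R| <= `|(y : R) + u| + 1.
    rewrite -{1}(addrK u (y : R)) (le_trans (ler_normB _ _))// lerD2l//.
  have [yJ|yJ] := leP `|y : R| (M + 1).
    have Jy : J y by rewrite /J /= itvcc_normE.
    have yJ1 : \1_J y = 1 :> R by rewrite indicE mem_set.
    have Ey : E y by rewrite /E /= itvcc_normE; lra.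
    have Eyu : E ((y : R) + u) by rewrite /E /= itvcc_normE; lra.
    rewrite yJ1 mulr1 ler_pM// /w !indicE !mem_set// !mulr1.
    rewrite [X in _ <= X](_ : _ = (`|b ((y : R) + u) - g ((y : R) + u)| + delta) + `|b y - g y|);
      last by ring.
    have -> : b ((y : R) + u) - b y = (b ((y : R) + u) - g ((y : R) + u)) +
        (g ((y : R) + u) - g y) - (b y - g y) by ring.
    rewrite (le_trans (ler_normB _ _))// lerD2r (le_trans (ler_normD _ _))//.
    by rewrite lerD2l; exact: ug.
  rewrite !bsupp ?subrr ?normr0 ?mulr0//; last 2 first.
  - by lra.
  - by lra.
  by apply: mulr_ge0; [rewrite mulr_ge0// ltW|rewrite !addr_ge0].
apply: (@le_trans _ _ (\int[mu]_y
    (2 * M * ((w ((y : R) + u) + w y) + delta * \1_J y))%:E)%E).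
  apply: ge0_le_integral => //.
  - by move=> y _; rewrite lee_fin sqr_ge0.
  - by apply/measurable_EFinP; apply: measurable_funX; exact: measurable_funB.
  - apply/measurable_EFinP; apply: measurable_funM => //.
    apply: measurable_funD; first exact: measurable_funD.
    by apply: measurable_funM => //; exact: measurable_indic.
  - by move=> y _; rewrite lee_fin pw.
under eq_integral do rewrite EFinM.
rewrite ge0_integralZl//; last 3 first.
- apply/measurable_EFinP.
  apply: measurable_funD; first exact: measurable_funD.
  by apply: measurable_funM => //; exact: measurable_indic.
- by move=> y _; rewrite lee_fin !addr_ge0.
- by rewrite lee_fin mulr_ge0// ltW.
under eq_integral do rewrite !EFinD.
rewrite ge0_integralD//; last 4 first.
- by move=> y _; rewrite -EFinD lee_fin addr_ge0.
- by apply: emeasurable_funD; exact/measurable_EFinP.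
- by move=> y _; rewrite lee_fin.
- by apply/measurable_EFinP; apply: measurable_funM => //; exact: measurable_indic.
rewrite ge0_integralD//; last 4 first.
- by move=> y _; rewrite lee_fin.
- exact/measurable_EFinP.
- by move=> y _; rewrite lee_fin.
- exact/measurable_EFinP.
rewrite ge0_integral_shift//.
under [X in (_ * (_ + X))%E]eq_integral do rewrite EFinM.
rewrite ge0_integralZl//; last 2 first.
- by apply/measurable_EFinP; exact: measurable_indic.
- by rewrite lee_fin ltW.
have -> : (\int[mu]_x (\1_J x)%:E = (2 * (M + 1))%:E)%E.
  by rewrite integral_indic// setIT; exact: muJ.
apply: (@le_trans _ _ ((2 * M)%:E * (e1%:E + e1%:E + delta%:E * (2 * (M + 1))%:E))%E).
  rewrite lee_pmul2l//; last by rewrite lte_fin mulr_gt0.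
  by rewrite leeD2r// leeD.
rewrite lee_fin le_eqVlt; apply/orP; left; apply/eqP.
rewrite /e1 /delta; field.
by rewrite !gt_eqF// addr_gt0.
Qed.

Lemma translation_L2 (a : mR -> R) (e : R) : measurable_fun setT a ->
  (\int[mu]_x (a x ^+ 2)%:E < +oo)%E -> 0 < e ->
  \forall u \near (0 : R),
    (\int[mu]_y ((a ((y : R) + u) - a y) ^+ 2)%:E <= e%:E)%E.
Proof.
move=> ma a2 e0.
have ma2 : measurable_fun setT (fun x => a x ^+ 2) by exact: measurable_funX.
have ia2 : mu.-integrable setT (EFin \o (fun x => a x ^+ 2)).
  by apply/ge0_integrableP => // x; exact: sqr_ge0.
pose S (n : nat) := [set x : mR | `|x : R| <= n.+1%:R] `&` [set x | `|a x| <= n.+1%:R].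
have mS n : measurable (S n).
  apply: measurableI; first exact: measurable_norm_le.
  rewrite -[X in measurable X]setTI.
  exact: (ma measurableT _ (measurable_norm_le n.+1%:R)).
have aS x : a x ^+ 2 != 0 -> \forall n \near \oo, S n x.
  move=> _; near=> n; split => /=.
    rewrite (@le_trans _ _ n%:R)// ?ler_nat//; near: n; exact: nbhs_infty_ger.
  rewrite (@le_trans _ _ n%:R)// ?ler_nat//; near: n; exact: nbhs_infty_ger.
have := cvg_integral_setC ia2 (fun x => sqr_ge0 (a x)) mS aS.
(* Error budget: 3 (e/12 + e/12 + e/6) = e. The two truncation errors, at y and at y + u, have equal
   integrals by translation invariance; e/6 is for the truncated function and 3 for the square of a
   sum of three terms. *)
move=> /cvge0_near_lt /(_ (divr_gt0 e0 (ltr0Sn R 11))) [n _ /(_ n (leqnn n)) /ltW an].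
pose b x := a x * \1_(S n) x.
have mb : measurable_fun setT b.
  by apply: measurable_funM => //; exact: measurable_indic.
have ab : (\int[mu]_x ((a x - b x) ^+ 2)%:E <= (e / 12)%:E)%E.
  apply: le_trans an; rewrite le_eqVlt; apply/orP; left; apply/eqP.
  apply: eq_integral => x _; congr EFin; rewrite /b !indicE in_setC.
  by case: (x \in S n) => /=; rewrite ?mulr1 ?mulr0 ?subrr ?subr0// expr0n.
have tb := @translation_bounded b n.+1%:R (e / 6) mb (ltr0Sn _ _) _ _ (divr_gt0 e0 (ltr0Sn R 5)).
have {}tb : \forall u \near (0 : R),
    (\int[mu]_y ((b ((y : R) + u) - b y) ^+ 2)%:E <= (e / 6)%:E)%E.
  apply: tb.
  - move=> x; rewrite /b indicE; case: (boolP (x \in S n)) => [/set_mem[_ /=]|_].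
      by rewrite mulr1.
    by rewrite mulr0 normr0.
  - move=> x Mx; rewrite /b indicE memNset ?mulr0// => -[/= + _].
    by rewrite leNgt Mx.
apply: filterS tb => u tbu.
have mau : measurable_fun setT (fun y : mR => a ((y : R) + u)).
  exact: (measurableT_comp ma (measurable_shift u)).
have mbu : measurable_fun setT (fun y : mR => b ((y : R) + u)).
  exact: (measurableT_comp mb (measurable_shift u)).
have mab : measurable_fun setT (fun x => (a x - b x) ^+ 2).
  by apply: measurable_funX; exact: measurable_funB.
have mabu : measurable_fun setT (fun y : mR => (a ((y : R) + u) - b ((y : R) + u)) ^+ 2).
  by apply: measurable_funX; exact: measurable_funB.
have mbb : measurable_fun setT (fun y : mR => (b ((y : R) + u) - b y) ^+ 2).
  by apply: measurable_funX; exact: measurable_funB.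
apply: (@le_trans _ _ (\int[mu]_y (3 * ((a ((y : R) + u) - b ((y : R) + u)) ^+ 2 +
    (a y - b y) ^+ 2 + (b ((y : R) + u) - b y) ^+ 2))%:E)%E).
  apply: ge0_le_integral => //.
  - by move=> y _; rewrite lee_fin sqr_ge0.
  - by apply/measurable_EFinP; apply: measurable_funX; exact: measurable_funB.
  - apply/measurable_EFinP; apply: measurable_funM => //.
    by apply: measurable_funD => //; exact: measurable_funD.
  - move=> y _; rewrite lee_fin.
    set p := a (_ + _); set q := b (_ + _); set r := a y; set t := b y.
    have := sqr_ge0 ((p - q) + (r - t)); have := sqr_ge0 ((p - q) - (q - t)).
    have := sqr_ge0 ((r - t) + (q - t)); nra.
under eq_integral do rewrite EFinM.
rewrite ge0_integralZl//; last 2 first.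
- apply/measurable_EFinP.
  by apply: measurable_funD => //; exact: measurable_funD.
- by move=> y _; rewrite lee_fin !addr_ge0 ?sqr_ge0.
under eq_integral do rewrite !EFinD.
rewrite ge0_integralD//; last 4 first.
- by move=> y _; rewrite -EFinD lee_fin addr_ge0 ?sqr_ge0.
- by apply: emeasurable_funD; exact/measurable_EFinP.
- by move=> y _; rewrite lee_fin sqr_ge0.
- exact/measurable_EFinP.
rewrite ge0_integralD//; last 4 first.
- by move=> y _; rewrite lee_fin sqr_ge0.
- exact/measurable_EFinP.
- by move=> y _; rewrite lee_fin sqr_ge0.
- exact/measurable_EFinP.
rewrite (ge0_integral_shift (f := fun x => (a x - b x) ^+ 2))//; last first.
  by move=> x; exact: sqr_ge0.
apply: (@le_trans _ _ (3%:E * ((e / 12)%:E + (e / 12)%:E + (e / 6)%:E))%E).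
  by rewrite lee_pmul2l// !leeD.
rewrite lee_fin le_eqVlt; apply/orP; left; apply/eqP; field.
Unshelve. all: by end_near. Qed.

End translation.

(** * Plancherel's identity on the line *)

Section plancherel_real.
Context {R : realType}.
Local Notation mu := (@lebesgue_measure R).
Local Notation mR := (measurableTypeR R).
Local Notation mu2 := (sfprod (@lebesgue_measure R) (@lebesgue_measure R)).
Local Notation ftR := (ft (@lebesgue_measure R) (fun x y : mR => (x : R) * y)).
Variable a : mR -> R.
Hypothesis ia : mu.-integrable setT (EFin \o a).
Hypothesis ia2 : mu.-integrable setT (EFin \o (fun x => a x ^+ 2)).

Let ma : measurable_fun setT a.
Proof. by have /integrableP[/measurable_EFinP] := ia. Qed.

Let a2fin : (\int[mu]_x (a x ^+ 2)%:E < +oo)%E.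
Proof.
apply/(ge0_integrableP mu (f := fun x => a x ^+ 2)) => //.
  exact: measurable_funX.
by move=> x; exact: sqr_ge0.
Qed.

Let N : R := \int[mu]_x (a x ^+ 2).

Let NE : (\int[mu]_x (a x ^+ 2)%:E)%E = N%:E.
Proof.
rewrite /N /Rintegral fineK// ge0_fin_numE//.
by apply: integral_ge0 => x _; rewrite lee_fin sqr_ge0.
Qed.

(** The square of the L^2 modulus of continuity of [a]. *)
Let omega (u : R) : \bar R := (\int[mu]_y ((a ((y : R) + u) - a y) ^+ 2)%:E)%E.

Let measurable_diff (u : R) :
  measurable_fun setT (fun y : mR => (a ((y : R) + u) - a y) ^+ 2).
Proof.
apply: measurable_funX; apply: measurable_funB => //.
exact: (measurableT_comp ma (measurable_shift u)).
Qed.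

Let omega_le (u : R) : (omega u <= (4 * N)%:E)%E.
Proof.
have ma2 : measurable_fun setT (fun y => a y ^+ 2) by exact: measurable_funX.
have mau2 : measurable_fun setT (fun y : mR => a ((y : R) + u) ^+ 2).
  exact: (measurableT_comp ma2 (measurable_shift u)).
apply: (@le_trans _ _ (\int[mu]_y (2 * (a ((y : R) + u) ^+ 2 + a y ^+ 2))%:E)%E).
  apply: ge0_le_integral => //.
  - by move=> y _; rewrite lee_fin sqr_ge0.
  - exact/measurable_EFinP.
  - by apply/measurable_EFinP; apply: measurable_funM => //; exact: measurable_funD.
  - move=> y _; rewrite lee_fin.
    have := sqr_ge0 (a ((y : R) + u) + a y); nra.
under eq_integral do rewrite EFinM.
rewrite ge0_integralZl//; last 2 first.
- by apply/measurable_EFinP; exact: measurable_funD.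
- by move=> y _; rewrite lee_fin addr_ge0 ?sqr_ge0.
under eq_integral do rewrite EFinD.
rewrite ge0_integralD//; last 4 first.
- by move=> y _; rewrite lee_fin sqr_ge0.
- exact/measurable_EFinP.
- by move=> y _; rewrite lee_fin sqr_ge0.
- exact/measurable_EFinP.
rewrite (ge0_integral_shift (f := fun x => a x ^+ 2))//; last by move=> x; exact: sqr_ge0.
by rewrite NE lee_fin; lra.
Qed.

(** Substituting x = y + u for fixed y and exchanging the integrals turns the double integral into
    an average of [omega] against the kernel. *)
Let diff_poissonE (c : R) : 0 < c ->
  (\int[mu2]_z ((a z.1 - a z.2) ^+ 2 * poisson c ((z.1 : R) - z.2))%:E =
   \int[mu]_u (omega u * (poisson c u)%:E))%E.
Proof.
move=> c0.
have mK : measurable_fun setT (poisson c : mR -> R).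
  exact: continuous_measurable_fun (@continuous_poisson R c c0).
rewrite sf_tonelli2; last 2 first.
- apply: measurable_funM.
    apply: measurable_funX; apply: measurable_funB.
      exact: (measurableT_comp ma measurable_fst).
    exact: (measurableT_comp ma measurable_snd).
  apply: (measurableT_comp mK).
  by apply: measurable_funB; [exact: measurable_fst|exact: measurable_snd].
- by move=> z; rewrite mulr_ge0 ?sqr_ge0 ?poisson_ge0.
transitivity (\int[mu]_y \int[mu]_u
    ((a ((y : R) + u) - a y) ^+ 2 * poisson c u)%:E)%E.
  apply: eq_integral => y _ /=.
  rewrite -(ge0_integral_shift
    (f := fun x : mR => (a x - a y) ^+ 2 * poisson c ((x : R) - y)) y); last 2 first.
  - apply: measurable_funM.
      apply: measurable_funX; exact: measurable_funB.
    by apply: (measurableT_comp mK); exact: measurable_funB.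
  - by move=> x; rewrite mulr_ge0 ?sqr_ge0 ?poisson_ge0.
  apply: eq_integral => u _; congr (((_ - _) ^+ 2 * _)%:E).
    by congr a; rewrite addrC.
  by congr poisson; rewrite addrK.
rewrite (sf_tonelli mu mu (f := fun z : mR * mR =>
  (a ((z.1 : R) + z.2) - a z.1) ^+ 2 * poisson c z.2)); last 2 first.
- apply: measurable_funM; last exact: (measurableT_comp mK measurable_snd).
  apply: measurable_funX; apply: measurable_funB.
    apply: (measurableT_comp ma).
    by apply: measurable_funD; [exact: measurable_fst|exact: measurable_snd].
  exact: (measurableT_comp ma measurable_fst).
- by move=> z; rewrite mulr_ge0 ?sqr_ge0 ?poisson_ge0.
apply: eq_integral => u _ /=.
under eq_integral do rewrite EFinM.
rewrite ge0_integralZr//.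
- exact/measurable_EFinP.
- by move=> y _; rewrite lee_fin sqr_ge0.
- by rewrite lee_fin poisson_ge0.
Qed.

(** Near 0, [omega] is at most e and the kernel has mass 1; away from 0, [omega] is at most 4 N and
    the kernel is O(c). The constant [C] depends on e but not on c, so c can be chosen
    afterwards. *)
Lemma diff_poisson_small (e : R) : 0 < e -> exists C : R, 0 <= C /\
  forall c, 0 < c ->
  \int[mu2]_z ((a z.1 - a z.2) ^+ 2 * poisson c ((z.1 : R) - z.2)) <= e + C * c.
Proof.
move=> e0.
have N0 : 0 <= N by apply: Rintegral_ge0 => x _; exact: sqr_ge0.
have /nbhs_ballP[d /= d0 dP] := translation_L2 ma a2fin e0.
pose C := 4 * N * (1 + (2 * pi * d) ^- 2).
have C0 : 0 <= C.
  by rewrite !mulr_ge0// addr_ge0// invr_ge0 sqr_ge0.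
exists C; split=> // c c0.
have mK (c' : R) : 0 < c' -> measurable_fun setT (poisson c' : mR -> R).
  by move=> c'0; exact: continuous_measurable_fun (@continuous_poisson R c' c'0).
have bnd u : (omega u * (poisson c u)%:E <=
    (e * poisson c u + C * c * poisson 1 u)%:E)%E.
  have [ud|du] := ltP `|u| d.
    apply: (@le_trans _ _ (e%:E * (poisson c u)%:E)%E).
      rewrite lee_wpmul2r// ?lee_fin ?poisson_ge0//.
      by apply: dP; rewrite /ball /= sub0r normrN.
    rewrite lee_fin lerDl; apply: mulr_ge0; last exact: poisson_ge0.
    by rewrite mulr_ge0// ltW.
  apply: (@le_trans _ _ ((4 * N)%:E * (poisson c u)%:E)%E).
    by rewrite lee_wpmul2r// lee_fin poisson_ge0.
  rewrite lee_fin.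
  apply: (@le_trans _ _ (4 * N * (c * (1 + (2 * pi * d) ^- 2) * poisson 1 u))).
    by rewrite ler_wpM2l ?mulr_ge0// poisson_tail.
  rewrite (_ : 4 * N * _ = C * c * poisson 1 u); last by rewrite /C; ring.
  by rewrite lerDr mulr_ge0 ?poisson_ge0// ltW.
have le1 : (\int[mu]_u (omega u * (poisson c u)%:E) <= (e + C * c)%:E)%E.
  apply: (@le_trans _ _ (\int[mu]_u (e * poisson c u + C * c * poisson 1 u)%:E)%E).
    apply: ge0_le_integral => //.
    - move=> u _; rewrite mule_ge0//; last by rewrite lee_fin poisson_ge0.
      by apply: integral_ge0 => y _; rewrite lee_fin sqr_ge0.
    - apply: emeasurable_funM; last by apply/measurable_EFinP; exact: mK.
      apply: (sf_measurable1 mu (f := fun z : mR * mR =>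
        (a ((z.2 : R) + z.1) - a z.2) ^+ 2)).
        apply: measurable_funX; apply: measurable_funB.
          apply: (measurableT_comp ma).
          by apply: measurable_funD; [exact: measurable_snd|exact: measurable_fst].
        exact: (measurableT_comp ma measurable_snd).
      by move=> z; exact: sqr_ge0.
    - by apply/measurable_EFinP; apply: measurable_funD;
        apply: measurable_funM => //; exact: mK.
  under eq_integral do rewrite EFinD.
  have Cc0 : 0 <= C * c by rewrite mulr_ge0// ltW.
  have Z (k c' : R) : 0 <= k -> 0 < c' -> (\int[mu]_u (k * poisson c' u)%:E = k%:E)%E.
    move=> k0 c'0; under eq_integral do rewrite EFinM.
    rewrite ge0_integralZl//; last 2 first.
    - by apply/measurable_EFinP; exact: mK.
    - by move=> u _; rewrite lee_fin poisson_ge0.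
    by rewrite integral_poisson// mule1.
  rewrite ge0_integralD//; last 4 first.
  - by move=> u _; rewrite lee_fin mulr_ge0 ?poisson_ge0// ltW.
  - by apply/measurable_EFinP; apply: measurable_funM => //; exact: mK.
  - by move=> u _; rewrite lee_fin mulr_ge0 ?poisson_ge0.
  - by apply/measurable_EFinP; apply: measurable_funM => //; exact: mK.
  by rewrite !Z// ltW.
rewrite /Rintegral diff_poissonE// -lee_fin fineK// ge0_fin_numE.
  by rewrite (le_lt_trans le1)// ltry.
apply: integral_ge0 => u _; rewrite mule_ge0//; last by rewrite lee_fin poisson_ge0.
by apply: integral_ge0 => y _; rewrite lee_fin sqr_ge0.
Qed.

Let F := ftR (fun x => (a x)%:C%C).

Let mF : measurable_fun setT (fun q => nsq (F q)).
Proof.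
apply: measurable_nsq; apply: (Cmeasurable_ft mu measurable_mulR).
exact: (Cintegrable_Cmeasurable (Cintegrable_realC ia)).
Qed.

Let mabel (c : R) : measurable_fun setT (abel c : mR -> R).
Proof. exact: continuous_measurable_fun (@continuous_abel R c). Qed.

Let integral_abelF (c : R) : 0 < c ->
  (\int[mu]_q (abel c q * nsq (F q))%:E =
   (N - 2^-1 * \int[mu2]_z ((a z.1 - a z.2) ^+ 2 * poisson c ((z.1 : R) - z.2)))%:E)%E.
Proof.
move=> c0; rewrite -(Rintegral_abel_ftE ia c0 ia2) /Rintegral fineK//.
exact: integrable_fin_num (integrable_abel_ft ia c0).
Qed.

Lemma plancherel_real :
  (\int[mu]_q (nsq (ftR (fun x => (a x)%:C%C) q))%:E =
   \int[mu]_x (a x ^+ 2)%:E)%E.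
Proof.
rewrite -/F NE; apply/eqP; rewrite eq_le; apply/andP; split.
  (* Upper bound: the Abel means for c = 1/(n+1) increase to the full integral, and each is at most
     [N] because the double integral subtracted from [N] is nonnegative. *)
  pose c (n : nat) : R := n.+1%:R^-1.
  have c0 n : 0 < c n by rewrite invr_gt0.
  pose f (n : nat) (q : mR) := (abel (c n) q * nsq (F q))%:E.
  have abel1 (q : R) : abel (c n) q @[n --> \oo] --> (1 : R).
    have h : - c n * `|q| @[n --> \oo] --> (0 : R).
      rewrite -[X in _ --> X](mul0r `|q|); apply: cvgM; last exact: cvg_cst.
      by rewrite -[X in _ --> X]oppr0; apply: cvgN; exact: cvg_harmonic.
    by rewrite -expR0; exact: (cvg_comp _ _ h (@continuous_expR R 0)).
  have flim q : limn (f ^~ q) = (nsq (F q))%:E.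
    apply/cvg_lim => //; apply: cvg_EFin; first exact: nearW.
    rewrite -[X in _ --> X]mul1r; apply: cvgM; last exact: cvg_cst.
    exact: abel1.
  have lim : (fun n => \int[mu]_q f n q)%E @ \oo --> (\int[mu]_q (nsq (F q))%:E)%E.
    under eq_integral => q _ do rewrite -flim.
    apply: cvg_monotone_convergence => //.
    - by move=> n; apply/measurable_EFinP; exact: measurable_funM.
    - by move=> n q _; rewrite lee_fin mulr_ge0 ?nsq_ge0// ltW// abel_gt0.
    - move=> q _ m n mn; rewrite lee_fin ler_wpM2r ?nsq_ge0// ler_expR.
      by rewrite ler_wpM2r// lerN2 lef_pV2 ?posrE// ler_nat.
  rewrite -(cvg_lim _ lim)//; apply: lime_le; first exact: (cvgP _ lim).
  apply: nearW => n; rewrite integral_abelF// lee_fin gerBl mulr_ge0//.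
  by apply: Rintegral_ge0 => z _; rewrite mulr_ge0 ?sqr_ge0 ?poisson_ge0.
apply/lee_addgt0Pr => e e0.
have [C [C0 CP]] := diff_poisson_small e0.
(* Lower bound: this choice gives C c <= e, so the Abel mean is at least N - (e + C c)/2 >= N - e.
   The 1 in the denominator covers C = 0. *)
pose c := e / (C + 1).
have c0 : 0 < c by rewrite divr_gt0// ltr_wpDl.
apply: (@le_trans _ _ (\int[mu]_q (abel c q * nsq (F q))%:E + e%:E)%E).
  rewrite integral_abelF// -EFinD lee_fin.
  have Cc : C * c <= e.
    by rewrite /c mulrA ler_pdivrMr ?ltr_wpDl// mulrC ler_pM2l// lerDl.
  have := CP c c0; lra.
rewrite leeD2r//; apply: ge0_le_integral => //.
- by move=> q _; rewrite lee_fin mulr_ge0 ?nsq_ge0// ltW// abel_gt0.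
- by apply/measurable_EFinP; exact: measurable_funM.
- exact/measurable_EFinP.
- move=> q _; rewrite lee_fin ler_piMl ?nsq_ge0//.
  by rewrite /abel -expR0 ler_expR mulNr oppr_le0 mulr_ge0// ltW.
Qed.

End plancherel_real.

(** * Plancherel's identity on the Heisenberg group *)

Section plancherel_R.
Context {R : realType}.
Local Notation mu := (@lebesgue_measure R).
Local Notation mR := (measurableTypeR R).
Local Notation ftR := (ft (@lebesgue_measure R) (fun x y : mR => (x : R) * y)).

Lemma ge0_integralN (f : mR -> R) : measurable_fun setT f ->
  (forall x, 0 <= f x) ->
  (\int[mu]_x (f (- (x : R)))%:E = \int[mu]_x (f x)%:E)%E.
Proof.
move=> mf f0; apply/esym.
apply: (ge0_integral_transport (m1 := mu) (m2 := mu)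
  (phi := (fun x : R => - x) : mR -> mR) _ _ (f := fun x => (f x)%:E)).
- exact: measurable_funN.
- by move=> A mA; rewrite -[LHS](lebesgue_measureN mA).
- exact/measurable_EFinP.
- by move=> x; rewrite lee_fin.
Qed.

Lemma ft_realN (a : mR -> R) (q : R) : mu.-integrable setT (EFin \o a) ->
  ftR (fun x => (a x)%:C%C) (- q) = (ftR (fun x => (a x)%:C%C) q)^*%C.
Proof.
move=> ia.
have [ir ii] := Cintegrable_character measurable_mulR q (Cintegrable_realC ia).
rewrite /ft /Cintegral /=; congr Complex.
- apply: eq_Rintegral => x _ /=.
  by rewrite mulNr mulrN opprK cosN !mul0r !subr0.
- rewrite -[RHS]mulN1r -RintegralZl//; apply: eq_Rintegral => x _ /=.
  by rewrite mulNr mulrN opprK sinN !mul0r !addr0 mulrN mulN1r opprK.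
Qed.

Lemma plancherel_R : plancherel (@lebesgue_measure R) (fun x y : mR => (x : R) * y).
Proof.
move=> h ih nh; have mh := Cintegrable_Cmeasurable ih.
pose a x := complex.Re (h x); pose b x := complex.Im (h x).
have [ia ib] : mu.-integrable setT (EFin \o a) /\ mu.-integrable setT (EFin \o b).
  by case: ih.
have ma : measurable_fun setT a by exact: mh.1.
have mb : measurable_fun setT b by exact: mh.2.
have ma2 : measurable_fun setT (fun x => a x ^+ 2) by exact: measurable_funX.
have mb2 : measurable_fun setT (fun x => b x ^+ 2) by exact: measurable_funX.
have inh : mu.-integrable setT (EFin \o (fun x => nsq (h x))).
  exact/(integrable_nsqP mu mh).
have ia2 : mu.-integrable setT (EFin \o (fun x => a x ^+ 2)).
  apply: le_integrable inh => //; first exact/measurable_EFinP.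
  by move=> x _; rewrite /= lee_fin !ger0_norm ?nsq_ge0 ?sqr_ge0// lerDl sqr_ge0.
have ib2 : mu.-integrable setT (EFin \o (fun x => b x ^+ 2)).
  apply: le_integrable inh => //; first exact/measurable_EFinP.
  by move=> x _; rewrite /= lee_fin !ger0_norm ?nsq_ge0 ?sqr_ge0// lerDr sqr_ge0.
pose Fa := ftR (fun x => (a x)%:C%C); pose Fb := ftR (fun x => (b x)%:C%C).
(* Here h = a + i b is written as a - (-i) b, the form to which [CintegralB] and [CintegralZl]
   apply. *)
have FE q : ftR h q = Fa q - Complex 0 (-1) * Fb q.
  rewrite /Fa /Fb /ft -CintegralZl; last first.
    exact: (Cintegrable_character measurable_mulR q (Cintegrable_realC ib)).
  rewrite -CintegralB.
  - congr Cintegral; apply/funext => x; rewrite [X in _ - X]mulrA -mulrBl; congr (_ * _).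
    by rewrite /a /b; case: (h x) => u v; congr Complex; rewrite /=; ring.
  - exact: (Cintegrable_character measurable_mulR q (Cintegrable_realC ia)).
  - have [ir ii] := Cintegrable_character measurable_mulR q (Cintegrable_realC ib).
    split.
    + apply: eq_integrable ii => // x _ /=; congr EFin; ring.
    + apply: eq_integrable (integrableN ir) => // x _ /=; congr EFin; ring.
have mF : measurable_fun setT (fun q => nsq (ftR h q)).
  by apply: measurable_nsq; exact: (Cmeasurable_ft mu measurable_mulR mh).
have mFa : measurable_fun setT (fun q => nsq (Fa q)).
  apply: measurable_nsq; apply: (Cmeasurable_ft mu measurable_mulR).
  exact: Cmeasurable_realC.
have mFb : measurable_fun setT (fun q => nsq (Fb q)).
  apply: measurable_nsq; apply: (Cmeasurable_ft mu measurable_mulR).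
  exact: Cmeasurable_realC.
have mFN : measurable_fun setT (fun q : mR => nsq (ftR h (- (q : R)))).
  by apply: (measurableT_comp mF); exact: measurable_funN.
(* As [Fa (- q)] and [Fb (- q)] are the conjugates of [Fa q] and [Fb q], the
   cross terms of the two squares cancel. *)
have key q : nsq (ftR h q) + nsq (ftR h (- q)) = 2 * (nsq (Fa q) + nsq (Fb q)).
  rewrite !FE /Fa /Fb !ft_realN//.
  case: (ftR _ q) => x y; case: (ftR _ q) => s t; rewrite /nsq /=; ring.
(* One of the two copies of the integral is reflected so that [key] applies pointwise; the factor 2
   is cancelled at the end. *)
have sum2 : (2%:E * \int[mu]_q (nsq (ftR h q))%:E =
    2%:E * \int[mu]_x (nsq (h x))%:E)%E.
  rewrite {1}(_ : 2 = 1 + 1)// EFinD ge0_muleDl// !mul1e.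
  rewrite -{2}(ge0_integralN mF); last by move=> q; exact: nsq_ge0.
  rewrite -ge0_integralD//; last 4 first.
  - by move=> q _; rewrite lee_fin nsq_ge0.
  - exact/measurable_EFinP.
  - by move=> q _; rewrite lee_fin nsq_ge0.
  - exact/measurable_EFinP.
  rewrite (eq_integral (fun q => 2%:E * (nsq (Fa q) + nsq (Fb q))%:E)%E); last first.
    by move=> q _; rewrite -EFinD key EFinM.
  rewrite ge0_integralZl//; last 2 first.
  - by apply/measurable_EFinP; exact: measurable_funD.
  - by move=> q _; rewrite lee_fin addr_ge0 ?nsq_ge0.
  congr (_ * _)%E; under eq_integral do rewrite EFinD.
  rewrite ge0_integralD//; last 4 first.
  - by move=> q _; rewrite lee_fin nsq_ge0.
  - exact/measurable_EFinP.
  - by move=> q _; rewrite lee_fin nsq_ge0.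
  - exact/measurable_EFinP.
  rewrite (plancherel_real ia ia2) (plancherel_real ib ib2) -ge0_integralD//.
  - by move=> q _; rewrite lee_fin sqr_ge0.
  - exact/measurable_EFinP.
  - by move=> q _; rewrite lee_fin sqr_ge0.
  - exact/measurable_EFinP.
have half x : (2^-1%:E * (2%:E * x) = x :> \bar R)%E.
  by rewrite muleA -EFinM mulVf// mul1e.
by rewrite -[LHS]half sum2 half.
Qed.

End plancherel_R.

Section plancherel_heis.
Context {R : realType}.
Local Notation mR := (measurableTypeR R).

Lemma measurable_dot n :
  measurable_fun setT (fun z : n.-tuple mR * n.-tuple mR => dot z.1 z.2).
Proof.
rewrite /dot; apply: measurable_sum => i; apply: measurable_funM.
  exact: (measurableT_comp (@measurable_tnth _ _ n i) measurable_fst).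
exact: (measurableT_comp (@measurable_tnth _ _ n i) measurable_snd).
Qed.

Lemma dot_tcons n (u v : mR * n.-tuple mR) :
  dot (tcons u) (tcons v) = add_pairing (fun x y : mR => (x : R) * y) (@dot R n) u v.
Proof.
rewrite /dot /add_pairing big_ord_recl; congr (_ + _).
by apply: eq_bigr => i _; rewrite /tcons /= !tnthS.
Qed.

Lemma plancherel_tuple n : plancherel (lebesgue_tuple R n) (@dot R n).
Proof.
elim: n => [|n IH].
  (* R^0 is a single point of mass 1 with zero pairing, so the transform is the identity. *)
  move=> h ih nh; apply: eq_integral => u _; congr (nsq _)%:E.
  have dR (f : 0.-tuple mR -> R) : measurable_fun setT f ->
      \int[\d_([tuple] : 0.-tuple mR)]_x f x = f u.
    move=> mf; rewrite /Rintegral integral_dirac//; last exact/measurable_EFinP.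
    by rewrite diracT mul1e /=; congr f; exact/esym/tuple0.
  have mh := Cintegrable_Cmeasurable ih.
  have d0 x : dot u x = 0 by rewrite /dot big_ord0.
  rewrite /ft (_ : (fun x => _) = h); last first.
    apply/funext => x; rewrite d0 mulr0 oppr0 /expi cos0 sin0.
    by rewrite -[RHS]mulr1.
  by rewrite /Cintegral /= !dR ?mh.1 ?mh.2//; [case: (h u)|exact: mh.2|exact: mh.1].
apply: (plancherel_transport (m1 := sfprod (@lebesgue_measure R) (lebesgue_tuple R n))
  (phi := tcons) (B1 := add_pairing (fun x y : mR => (x : R) * y) (@dot R n))).
- exact: measurable_tcons.
- by [].
- exact: dot_tcons.
- exact: measurable_dot.
- apply: plancherel_tensor => //.
  + exact: measurable_mulR.
  + exact: measurable_dot.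
  + exact: plancherel_R.
Qed.

(** The transform is the Euclidean one, so only the product structure R^n x R^n x R matters;
    [heis_inner] is the iterated [add_pairing] by conversion. *)
Lemma plancherel_heis n : plancherel (lebesgue_heis R n) heis_inner.
Proof.
apply: (plancherel_tensor (B1 := add_pairing (@dot R n) (@dot R n))
  (B2 := fun x y : mR => (x : R) * y)).
- by apply: measurable_add_pairing; exact: measurable_dot.
- exact: measurable_mulR.
- by apply: plancherel_tensor; [exact: measurable_dot|exact: measurable_dot|
    exact: plancherel_tuple|exact: plancherel_tuple].
- exact: plancherel_R.
Qed.

Lemma measurable_heis_inner n :
  measurable_fun setT (fun z : heis R n * heis R n => heis_inner z.1 z.2).
Proof.
apply: (measurable_add_pairing (B1 := add_pairing (@dot R n) (@dot R n))
  (B2 := fun x y : mR => (x : R) * y)).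
  by apply: measurable_add_pairing; exact: measurable_dot.
exact: measurable_mulR.
Qed.

End plancherel_heis.

(** * The Fourier transform on L^2 *)

Lemma limn_esup_bound {R : realType} (u : nat -> \bar R) (k : nat) (a b : \bar R) :
  (forall m, (k <= m)%N -> (a <= u m <= b)%E) -> (a <= limn_esup u <= b)%E.
Proof.
move=> uab; rewrite limn_esup_lim (cvg_lim _ (@cvg_esups_inf _ u))//.
apply/andP; split.
  apply: le_ereal_inf_tmp => _ [n _ <-].
  apply: (@le_trans _ _ (u (maxn n k))).
    by have /andP[] := uab (maxn n k) (leq_maxr _ _).
  apply: ereal_sup_ubound; exists (maxn n k) => //=; exact: leq_maxl.
apply: (@le_trans _ _ (esups u k)).
  by apply: ereal_inf_lbound; exists k.
by apply: ge_ereal_sup => _ [m /= km <-]; have /andP[] := uab m km.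
Qed.

Section L2_complete.
Context {d} {T : measurableType d} {R : realType}.
Variable mu : {measure set T -> \bar R}.

(** The increments are at most sqrt C / 2^j, and these bounds add up to 2 sqrt C / 2^k from k on.
    The induction carries the exact partial sum, since the bound on the whole tail would not
    reproduce itself. *)
Lemma geometric_chain (g : nat -> R) (C : R) :
  0 <= C -> (forall j, (g j.+1 - g j) ^+ 2 <= C * 4^-1 ^+ j) ->
  forall k m, (k <= m)%N -> `|g m - g k| <= 2 * Num.sqrt C * 2^-1 ^+ k.
Proof.
move=> C0 gC k m km.
have d1 j : `|g j.+1 - g j| <= Num.sqrt C * 2^-1 ^+ j.
  rewrite -(ler_pXn2r (ltn0Sn 1)) ?nnegrE ?mulr_ge0 ?sqrtr_ge0 ?exprn_ge0//.
  rewrite real_normK ?num_real// exprMn sqr_sqrtr// -exprM mulnC exprM.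
  by rewrite (_ : 2^-1 ^+ 2 = 4^-1)// exprVn -natrX.
have key i : `|g (k + i)%N - g k| <= 2 * Num.sqrt C * (2^-1 ^+ k - 2^-1 ^+ (k + i)).
  elim: i => [|i IH]; first by rewrite addn0 !subrr normr0 mulr0.
  rewrite addnS -(subrK (g (k + i)%N) (g (k + i).+1)) -addrA.
  rewrite (le_trans (ler_normD _ _))//.
  rewrite (le_trans (lerD (d1 _) IH))// [2^-1 ^+ (k + i).+1]exprS.
  by rewrite le_eqVlt; apply/orP; left; apply/eqP; field.
rewrite -(subnKC km) (le_trans (key _))// ler_wpM2l ?mulr_ge0 ?sqrtr_ge0//.
by rewrite gerBl exprn_ge0.
Qed.

(** The assumed rate makes the sum [s] of the squared increments weighted by 4^k integrate to at
    most 1. It then gives (F - G_k)^2 <= 4 * 4^-k * s almost everywhere, and integrating this yields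
    the stated rate directly. The limit is taken as an upper limit, which is measurable even where
    the sequence diverges. *)
Lemma L2_complete (G : nat -> T -> R) :
  (forall k, measurable_fun setT (G k)) ->
  (forall k, (\int[mu]_x ((G k.+1 x - G k x) ^+ 2)%:E <=
    (2^-1 ^+ k.+1 * 4^-1 ^+ k)%:E)%E) ->
  exists F : T -> R, measurable_fun setT F /\
    forall k, (\int[mu]_x ((F x - G k x) ^+ 2)%:E <= (4 * 4^-1 ^+ k)%:E)%E.
Proof.
move=> mG GG.
pose t k x := 4 ^+ k * (G k.+1 x - G k x) ^+ 2.
have t0 k x : 0 <= t k x by rewrite mulr_ge0 ?sqr_ge0// exprn_ge0.
have mt k : measurable_fun setT (t k).
  by apply: measurable_funM => //; apply: measurable_funX; exact: measurable_funB.
pose s x : \bar R := (\sum_(k <oo) (t k x)%:E)%E.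
have s0 x : (0 <= s x)%E by apply: nneseries_ge0 => k _ _; rewrite lee_fin.
have ms : measurable_fun setT s.
  by apply: ge0_emeasurable_sum => k => [x _ _|_]; [rewrite lee_fin|exact/measurable_EFinP].
have s1 : (\int[mu]_x s x <= 1)%E.
  rewrite integral_nneseries//; last 2 first.
  - by move=> k; exact/measurable_EFinP.
  - by move=> k x _; rewrite lee_fin.
  have := @cvg_geometric_eseries_half R 1 0; rewrite expr0 divr1 => h.
  rewrite -(cvg_lim _ h)//; apply: lee_nneseries => [k _ _|k _].
    by apply: integral_ge0 => x _; rewrite lee_fin.
  rewrite /t; under eq_integral do rewrite EFinM.
  rewrite ge0_integralZl//; last 2 first.
  - by apply/measurable_EFinP; apply: measurable_funX; exact: measurable_funB.
  - by move=> x _; rewrite lee_fin sqr_ge0.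
  apply: (@le_trans _ _ ((4 ^+ k)%:E * (2^-1 ^+ k.+1 * 4^-1 ^+ k)%:E)%E).
    by rewrite lee_wpmul2l// lee_fin exprn_ge0.
  rewrite -EFinM lee_fin mulrCA -exprMn divff// expr1n mulr1.
  by rewrite addn1 natrX exprVn mul1r.
(* Where [s x] is finite, [G m x] stays within 2 sqrt (s x) / 2 ^ k of [G k x]
   for all m >= k, and so does the upper limit. *)
exists (fun x => fine (limn_esup (fun k => (G k x)%:E))).
have mF : measurable_fun setT (fun x => fine (limn_esup (fun k => (G k x)%:E))).
  apply: (measurableT_comp (fine_measurable measurableT)).
  by apply: measurable_fun_limn_esup => k; exact/measurable_EFinP.
split => // k.
have is_ : mu.-integrable setT s.
  apply/integrableP; split => //; under eq_integral do rewrite gee0_abs//.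
  by rewrite (le_lt_trans s1)// ltry.
apply: (@le_trans _ _ (\int[mu]_x ((4 * 4^-1 ^+ k)%:E * s x))%E).
  apply: ae_ge0_le_integral => //.
  - by move=> x _; rewrite lee_fin sqr_ge0.
  - by apply/measurable_EFinP; apply: measurable_funX; exact: measurable_funB.
  - by move=> x _; rewrite mule_ge0// lee_fin mulr_ge0// exprn_ge0.
  - exact: measurable_funeM.
  have := integrable_ae measurableT is_; apply: filterS => x /(_ I) sfin _.
  pose C := fine (s x).
  have C0 : 0 <= C by rewrite fine_ge0.
  have sC : s x = C%:E by rewrite fineK.
  have gC j : (G j.+1 x - G j x) ^+ 2 <= C * 4^-1 ^+ j.
    have : ((t j x)%:E <= s x)%E.
      have := @nneseries_lim_ge R (fun k => (t k x)%:E) xpredT 0 j.+1.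
      move=> /(_ (fun _ _ _ => t0 _ _)); apply: le_trans.
      by rewrite big_nat_recr//= leeDr// sume_ge0// => i _; rewrite lee_fin.
    by rewrite sC lee_fin /t mulrC -ler_pdivlMr ?exprn_gt0// exprVn.
  have ch := geometric_chain C0 gC (k := k).
  set del := 2 * Num.sqrt C * 2^-1 ^+ k in ch.
  have := @limn_esup_bound R (fun m => (G m x)%:E) k (G k x - del)%:E (G k x + del)%:E _.
  have bd m : (k <= m)%N -> ((G k x - del)%:E <= (G m x)%:E <= (G k x + del)%:E)%E.
    move=> /ch; rewrite ler_norml !lee_fin => /andP[]; lra.
  move=> /(_ bd) /andP[le1 le2].
  have Lfin : limn_esup (fun m => (G m x)%:E) \is a fin_num.
    by rewrite fin_numE; apply/andP; split; apply/eqP => E; rewrite E in le1 le2.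
  move: le1 le2; rewrite -{1 2}(fineK Lfin) !lee_fin => le1 le2.
  rewrite sC lee_fin.
  have -> : 4 * 4^-1 ^+ k * C = del ^+ 2.
    rewrite /del !exprMn sqr_sqrtr// -exprM mulnC exprM.
    by rewrite (_ : 2^-1 ^+ 2 = 4^-1 :> R); [ring|rewrite exprVn -natrX].
  rewrite -real_normK ?num_real// ler_pXn2r ?nnegrE ?normr_ge0//.
    by rewrite ler_norml; apply/andP; split; lra.
  by rewrite /del !mulr_ge0 ?sqrtr_ge0// exprn_ge0.
have c0 : (0 <= (4 * 4^-1 ^+ k : R)%:E)%E by rewrite lee_fin mulr_ge0// exprn_ge0.
rewrite ge0_integralZl//.
rewrite -[leRHS]mule1 lee_wpmul2l// lee_fin mulr_ge0// exprn_ge0//.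
Qed.

End L2_complete.

(** * Squared norms and truncation of complex-valued functions *)

Section CLnorm.
Context {d} {T : measurableType d} {R : realType}.
Variable mu : {measure set T -> \bar R}.
Implicit Types h u v : T -> R[i].

Lemma CLnorm2E h : CLnorm mu 2%:E h = ((\int[mu]_x (nsq (h x))%:E) `^ 2^-1)%E.
Proof.
rewrite /CLnorm unlock; congr (_ `^ _)%E; apply: eq_integral => x _.
by rewrite /= ger0_norm ?normc_ge0// powR_mulrn ?normc_ge0// sqr_normcE.
Qed.

Lemma integral_nsq_ge0 h : (0 <= \int[mu]_x (nsq (h x))%:E)%E.
Proof. by apply: integral_ge0 => x _; rewrite lee_fin nsq_ge0. Qed.

Lemma CLnorm2_fin h x : (\int[mu]_x (nsq (h x))%:E)%E = x%:E ->
  CLnorm mu 2%:E h = (Num.sqrt x)%:E.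
Proof.
move=> hx; rewrite CLnorm2E hx poweR_EFin powR12_sqrt//.
by rewrite -lee_fin -hx integral_nsq_ge0.
Qed.

Lemma CLnorm2_lty h : (CLnorm mu 2%:E h < +oo)%E <->
  (\int[mu]_x (nsq (h x))%:E < +oo)%E.
Proof.
rewrite CLnorm2E; split; last exact: poweR_lty.
by apply: lty_poweRy; rewrite invr_eq0.
Qed.

Lemma CLp2P h : CLp mu 2%:E h <->
  Cmeasurable h /\ (\int[mu]_x (nsq (h x))%:E < +oo)%E.
Proof.
split=> [[mr mi /CLnorm2_lty]|[[mr mi] /CLnorm2_lty]]; by do 2?split.
Qed.

Lemma CLp1P h : CLp mu 1%:E h <-> Cintegrable mu h.
Proof.
have N1 : CLnorm mu 1%:E h = (\int[mu]_x (Normc.normc (h x))%:E)%E.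
  rewrite /CLnorm Lnorm1; apply: eq_integral => x _.
  by rewrite /= ger0_norm ?normc_ge0.
split=> [[mr mi]|ih].
  rewrite N1 => nh; apply: (@le_Cintegrable _ _ _ _ _ (fun x => Normc.normc (h x))) => //.
  apply/ge0_integrableP => //; first exact: measurable_normc.
  by move=> x; exact: normc_ge0.
have mh := Cintegrable_Cmeasurable ih; split; [exact: mh.1|exact: mh.2|].
rewrite N1; apply/(ge0_integrableP mu (f := fun x => Normc.normc (h x))).
- exact: measurable_normc.
- by move=> x; exact: normc_ge0.
- exact: Cintegrable_normc.
Qed.

Lemma CLnorm2_lt h (e : R) : 0 < e ->
  (\int[mu]_x (nsq (h x))%:E < (e ^+ 2)%:E)%E = (CLnorm mu 2%:E h < e%:E)%E.
Proof.
move=> e0; have := integral_nsq_ge0 h.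
case E : (\int[mu]_x (nsq (h x))%:E)%E => [x| |//] x0.
  rewrite (CLnorm2_fin E) !lte_fin -[RHS](ltr_pXn2r (ltn0Sn 1)) ?nnegrE ?sqrtr_ge0 ?(ltW e0)//.
  by rewrite sqr_sqrtr.
by rewrite CLnorm2E E poweRyr ?invr_eq0// !ltNge !leey.
Qed.

Lemma CLnorm2_cvg0 (g : nat -> T -> R[i]) :
  (fun k => CLnorm mu 2%:E (g k)) @ \oo --> 0%E <->
  forall e : R, 0 < e ->
    \forall k \near \oo, (\int[mu]_x (nsq (g k x))%:E < e%:E)%E.
Proof.
split=> [g0 e e0|g0].
  have se : 0 < Num.sqrt e by rewrite sqrtr_gt0.
  apply: filterS (cvge0_near_lt g0 se) => k.
  by rewrite -CLnorm2_lt// sqr_sqrtr// ltW.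
have near_lt e : 0 < e -> \forall k \near \oo, (CLnorm mu 2%:E (g k) < e%:E)%E.
  move=> e0; apply: filterS (g0 _ (exprn_gt0 2 e0)) => k.
  by rewrite CLnorm2_lt.
have ge0 k : (0 <= CLnorm mu 2%:E (g k))%E by exact: Lnorm_ge0.
apply/fine_cvgP; split.
  apply: filterS (near_lt 1 ltr01) => k gk; rewrite ge0_fin_numE//.
  by rewrite (lt_trans gk)// ltry.
apply/cvgrPdist_lt => e e0; apply: filterS (near_lt e e0) => k gk /=.
rewrite sub0r normrN ger0_norm ?fine_ge0// -lte_fin fineK// ge0_fin_numE//.
by rewrite (lt_trans gk)// ltry.
Qed.

(** A substitute for the triangle inequality that stays with squared norms and allows infinite
    values. *)
Lemma integral_nsq_le u v : Cmeasurable u -> Cmeasurable v ->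
  (\int[mu]_x (nsq (u x))%:E <= 2%:E * \int[mu]_x (nsq (v x))%:E
     + 2%:E * \int[mu]_x (nsq (v x - u x))%:E)%E.
Proof.
move=> mu_ mv.
have m1 : measurable_fun setT (fun x => (nsq (v x))%:E).
  by apply/measurable_EFinP; exact: measurable_nsq.
have m2 : measurable_fun setT (fun x => (nsq (v x - u x))%:E).
  by apply/measurable_EFinP; apply: measurable_nsq; exact: CmeasurableB.
have p1 x : (0 <= (nsq (v x))%:E)%E by rewrite lee_fin nsq_ge0.
have p2 x : (0 <= (nsq (v x - u x))%:E)%E by rewrite lee_fin nsq_ge0.
rewrite -!ge0_integralZl// -ge0_integralD//; first last.
- exact: measurable_funeM.
- by move=> x _; rewrite mule_ge0.
- exact: measurable_funeM.
- by move=> x _; rewrite mule_ge0.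
apply: ge0_le_integral => //.
- by move=> x _; rewrite lee_fin nsq_ge0.
- by apply/measurable_EFinP; exact: measurable_nsq.
- by apply: emeasurable_funD; exact: measurable_funeM.
- move=> x _; rewrite -!EFinM -EFinD lee_fin.
  rewrite -[X in nsq X <= _](subKr (v x)).
  rewrite (le_trans (nsqD_le _ _))// lerD2l.
  by rewrite nsqN.
Qed.

Lemma integral_nsqBC u v :
  (\int[mu]_x (nsq (u x - v x))%:E = \int[mu]_x (nsq (v x - u x))%:E)%E.
Proof.
by apply: eq_integral => x _; rewrite -nsqN opprB.
Qed.

(** An L^2 function can fail to be integrable only through its small values, so these are cut off:
    where |f|^2 >= 1/(n+1), one has |f| <= (n+1) |f|^2. *)
Lemma L2_truncation (f : T -> R[i]) (e : R) : Cmeasurable f ->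
  (\int[mu]_x (nsq (f x))%:E < +oo)%E -> 0 < e ->
  exists h : T -> R[i], [/\ Cintegrable mu h,
    (\int[mu]_x (nsq (h x))%:E < +oo)%E &
    (\int[mu]_x (nsq (h x - f x))%:E <= e%:E)%E].
Proof.
move=> mf nf e0.
have inf := (integrable_nsqP mu mf).2 nf.
have mnf := measurable_nsq mf.
pose S (n : nat) := [set x | n.+1%:R^-1 <= nsq (f x)].
have mS n : measurable (S n).
  rewrite (_ : S n = (fun x => nsq (f x)) @^-1` [set` `[n.+1%:R^-1, +oo[]).
    rewrite -[X in measurable X]setTI.
    exact: (mnf measurableT _ (measurable_itv `[n.+1%:R^-1, +oo[)).
  by apply/seteqP; split => x /=; rewrite in_itv/= andbT.
have fS x : nsq (f x) != 0 -> \forall n \near \oo, S n x.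
  move=> fx0; have fx : 0 < nsq (f x) by rewrite lt_neqAle eq_sym fx0 nsq_ge0.
  near=> n; rewrite /S /= invf_ple ?posrE//.
  rewrite (@le_trans _ _ n%:R)// ?ler_nat//; near: n; exact: nbhs_infty_ger.
have := cvg_integral_setC inf (fun x => nsq_ge0 (f x)) mS fS.
move=> /cvge0_near_lt /(_ e0) [n _ /(_ n (leqnn n)) /ltW an].
pose h x := f x * (\1_(S n) x)%:C%C.
have mh : Cmeasurable h.
  apply: CmeasurableM => //; apply: Cmeasurable_realC.
  exact: measurable_indic.
have nh x : nsq (h x) <= nsq (f x).
  rewrite /h nsqM nsq_realC ler_piMr ?nsq_ge0//.
exists h; split.
- have ig : mu.-integrable setT (EFin \o (fun x => n.+1%:R * nsq (f x))).
    by apply: eq_integrable (integrableZl measurableT n.+1%:R inf).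
  apply: (le_Cintegrable mh ig) => x.
  rewrite /h indicE; case: (boolP (x \in S n)) => [/set_mem|_]; last first.
    by rewrite mulr0 /Normc.normc /= expr0n addr0 sqrtr0 mulr_ge0 ?nsq_ge0.
  rewrite mulr1 /S /= -sqr_normcE.
  have := normc_ge0 (f x); set r := Normc.normc _ => r0.
  rewrite -(ler_pM2l (ltr0Sn R n)) mulfV// => nr.
  have n1 : 1 <= n.+1%:R :> R by rewrite ler1n.
  (* If r <= 1 then r <= 1 <= (n+1) r^2; otherwise r <= r^2. *)
  by have [r1|/ltW r1] := lerP r 1; nra.
- apply: le_lt_trans nf; apply: ge0_le_integral => //.
  + by move=> x _; rewrite lee_fin nsq_ge0.
  + by apply/measurable_EFinP; exact: measurable_nsq.
  + exact/measurable_EFinP.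
  + by move=> x _; rewrite lee_fin nh.
- apply: le_trans an; rewrite le_eqVlt; apply/orP; left; apply/eqP.
  apply: eq_integral => x _; congr EFin.
  rewrite /h !indicE in_setC; case: (x \in S n) => /=.
    by rewrite mulr1 mulr0 subrr /nsq /= expr0n addr0.
  by rewrite mulr0 mulr1 sub0r nsqN.
Unshelve. all: by end_near. Qed.

End CLnorm.

Section extension.
Context {d} {T : measurableType d} {R : realType}.
Variables (mu : {sigma_finite_measure set T -> \bar R}) (B : T -> T -> R).
Hypothesis mB : measurable_fun setT (fun z : T * T => B z.1 z.2).
Hypothesis PB : plancherel mu B.

Lemma plancherelB (h k : T -> R[i]) :
  Cintegrable mu h -> (\int[mu]_x (nsq (h x))%:E < +oo)%E ->
  Cintegrable mu k -> (\int[mu]_x (nsq (k x))%:E < +oo)%E ->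
  (\int[mu]_x (nsq (ft mu B h x - ft mu B k x))%:E =
   \int[mu]_x (nsq (h x - k x))%:E)%E.
Proof.
move=> ih nh ik nk.
have mh := Cintegrable_Cmeasurable ih; have mk := Cintegrable_Cmeasurable ik.
rewrite -(PB (CintegrableB ih ik)).
  by rewrite (ftB mB ih ik).
apply: (le_lt_trans (integral_nsq_le mu (CmeasurableB mh mk) mh)).
rewrite lte_add_pinfty// lte_mul_pinfty//.
rewrite (eq_integral (fun x => (nsq (k x))%:E))// => x _.
by rewrite opprB addrC subrK.
Qed.

Lemma fourier_L2_exists (f : T -> R[i]) : Cmeasurable f ->
  (\int[mu]_x (nsq (f x))%:E < +oo)%E ->
  exists F : T -> R[i], [/\ Cmeasurable F, (\int[mu]_x (nsq (F x))%:E < +oo)%E &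
    exists h : nat -> T -> R[i],
    [/\ forall k, Cintegrable mu (h k) /\ (\int[mu]_x (nsq (h k x))%:E < +oo)%E,
      forall e : R, 0 < e ->
        \forall k \near \oo, (\int[mu]_x (nsq (h k x - f x))%:E < e%:E)%E &
      forall e : R, 0 < e ->
        \forall k \near \oo, (\int[mu]_x (nsq (ft mu B (h k) x - F x))%:E < e%:E)%E]].
Proof.
move=> mf nf.
(* The rate is dictated by [L2_complete]: consecutive truncations differ by at most 2 * 8^-(k+2) + 2
   * 8^-(k+1) in squared norm, which is below 4 * 8^-(k+1) = 2^-(k+1) * 4^-k. *)
have r0 (k : nat) : 0 < (8^-1 : R) ^+ k.+1 by rewrite exprn_gt0.
have /choice[h hP] := fun k => L2_truncation mf nf (r0 k).
have ih k : Cintegrable mu (h k) by have [] := hP k.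
have nh k : (\int[mu]_x (nsq (h k x))%:E < +oo)%E by have [] := hP k.
have hf k : (\int[mu]_x (nsq (h k x - f x))%:E <= (8^-1 ^+ k.+1)%:E)%E by have [] := hP k.
have mh k := Cintegrable_Cmeasurable (ih k).
pose G k := ft mu B (h k).
have mG k : Cmeasurable (G k) by exact: Cmeasurable_ft.
have GG k : (\int[mu]_x (nsq (G k.+1 x - G k x))%:E <= (2^-1 ^+ k.+1 * 4^-1 ^+ k)%:E)%E.
  rewrite plancherelB//.
  apply: (le_trans (integral_nsq_le mu (CmeasurableB (mh _) (mh _)) (CmeasurableB (mh k.+1) mf))).
  rewrite [X in (_ + _ * X <= _)%E](eq_integral (fun x => (nsq (h k x - f x))%:E)); last first.
    by move=> x _; congr (nsq _)%:E; rewrite opprB addrC addrA subrK.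
  apply: (@le_trans _ _ (2%:E * (8^-1 ^+ k.+2)%:E + 2%:E * (8^-1 ^+ k.+1)%:E)%E).
    by rewrite leeD// lee_wpmul2l.
  rewrite -!EFinM -EFinD lee_fin.
  have -> : 2^-1 ^+ k.+1 * 4^-1 ^+ k = 4 * (8^-1 : R) ^+ k.+1.
    rewrite exprS -mulrA -exprMn exprS mulrA; congr (_ * _); first by field.
    by congr (_ ^+ _); field.
  rewrite [8^-1 ^+ k.+2]exprS.
  by have := r0 k; set y := _ ^+ _; lra.
have part (p : R[i] -> R) : (forall z w, p (z - w) = p z - p w) ->
    (forall z, p z ^+ 2 <= nsq z) -> (forall k, measurable_fun setT (fun x => p (G k x))) ->
    exists F : T -> R, measurable_fun setT F /\
    forall k, (\int[mu]_x ((F x - p (G k x)) ^+ 2)%:E <= (4 * 4^-1 ^+ k)%:E)%E.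
  move=> pB pn mp; apply: L2_complete => // k; apply: le_trans (GG k).
  apply: ge0_le_integral => //.
  - by move=> x _; rewrite lee_fin sqr_ge0.
  - by apply/measurable_EFinP; apply: measurable_funX; exact: measurable_funB.
  - by apply/measurable_EFinP; apply: measurable_nsq; exact: CmeasurableB.
  - by move=> x _; rewrite lee_fin -pB.
have [F1 [mF1 F1P]] : exists F : T -> R, measurable_fun setT F /\
    forall k, (\int[mu]_x ((F x - complex.Re (G k x)) ^+ 2)%:E <= (4 * 4^-1 ^+ k)%:E)%E.
  apply: part => [[? ?] [? ?]//|[a b]|k]; last exact: (mG k).1.
  by rewrite /nsq /= lerDl sqr_ge0.
have [F2 [mF2 F2P]] : exists F : T -> R, measurable_fun setT F /\
    forall k, (\int[mu]_x ((F x - complex.Im (G k x)) ^+ 2)%:E <= (4 * 4^-1 ^+ k)%:E)%E.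
  apply: part => [[? ?] [? ?]//|[a b]|k]; last exact: (mG k).2.
  by rewrite /nsq /= lerDr sqr_ge0.
pose F x := Complex (F1 x) (F2 x).
have mF : Cmeasurable F by [].
have GF k : (\int[mu]_x (nsq (G k x - F x))%:E <= (8 * 4^-1 ^+ k)%:E)%E.
  rewrite (eq_integral (fun x => ((F1 x - complex.Re (G k x)) ^+ 2)%:E +
    ((F2 x - complex.Im (G k x)) ^+ 2)%:E)%E); last first.
    by move=> x _; rewrite -EFinD /F; case: (G k x) => a b; rewrite /nsq /=; congr EFin; ring.
  have m1 : measurable_fun setT (fun x => ((F1 x - complex.Re (G k x)) ^+ 2)%:E).
    by apply/measurable_EFinP; apply: measurable_funX; apply: measurable_funB => //;
      exact: (mG k).1.
  have m2 : measurable_fun setT (fun x => ((F2 x - complex.Im (G k x)) ^+ 2)%:E).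
    by apply/measurable_EFinP; apply: measurable_funX; apply: measurable_funB => //;
      exact: (mG k).2.
  rewrite ge0_integralD//; last 2 first.
  - by move=> x _; rewrite lee_fin sqr_ge0.
  - by move=> x _; rewrite lee_fin sqr_ge0.
  apply: (le_trans (leeD (F1P k) (F2P k))).
  by rewrite -EFinD lee_fin; lra.
have geo (c q e : R) : 0 < e -> `|q| < 1 -> \forall k \near \oo, c * q ^+ k < e.
  by move=> e0 q1; exact: (cvgr_lt _ (cvg_geometric c q1)).
exists F; split => //.
  apply: (le_lt_trans (integral_nsq_le mu mF (mG 0%N))).
  rewrite lte_add_pinfty// lte_mul_pinfty//.
    by rewrite PB.
  by rewrite (le_lt_trans (GF 0%N))// ltry.
exists h; split => // e e0.
- apply: filterS (geo 8^-1 8^-1 e e0 _) => [k ke|].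
    by rewrite (le_lt_trans (hf k))// lte_fin exprS.
  by rewrite ger0_norm// invf_lt1// ltr1n.
- apply: filterS (geo 8 4^-1 e e0 _) => [k ke|].
    by rewrite (le_lt_trans (GF k))// lte_fin.
  by rewrite ger0_norm// invf_lt1// ltr1n.
Qed.

End extension.

Section fourier_heis.
Context {R : realType} {n : nat}.
Local Notation mu := (lebesgue_heis R n).

(** This excludes the default value in [fourier]: the set from which it chooses is nonempty for
    every f in L^2. *)
Lemma fourierP (f : heis R n -> R[i]) : CLp mu 2%:E f -> is_fourier f (fourier f).
Proof.
move=> /CLp2P[mf nf].
have [F [mF nF [h [hP hf hF]]]] :=
  fourier_L2_exists (measurable_heis_inner (n := n)) (@plancherel_heis R n) mf nf.
apply: (@xgetPex _ (fun=> 0) [set F | is_fourier f F]); exists F.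
split; first exact/CLp2P.
exists h; split.
- move=> k; split; first by apply/CLp1P; exact: (hP k).1.
  apply/CLp2P; split; last exact: (hP k).2.
  exact: Cintegrable_Cmeasurable (hP k).1.
- exact/CLnorm2_cvg0.
- exact/CLnorm2_cvg0.
Qed.

(** The approximating h_k is compared with f and its transform with F, each at the cost of a factor
    2, hence the 4. The estimate holds for every representative [F], in particular for the one
    chosen by [fourier]. *)
Lemma is_fourier_norm (f F : heis R n -> R[i]) : CLp mu 2%:E f ->
  is_fourier f F ->
  (\int[mu]_x (nsq (f x))%:E <= 4%:E * \int[mu]_x (nsq (F x))%:E)%E.
Proof.
move=> /CLp2P[mf nf] [/CLp2P[mF nF] [h [hP /CLnorm2_cvg0 hf /CLnorm2_cvg0 hF]]].
apply/lee_addgt0Pr => e e0.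
(* The errors add up to 2 * 2 * (e/6) + 2 * (e/6) = e. *)
have e6 : 0 < e / 6 by rewrite divr_gt0.
have /= [k _ /(_ k (leqnn k)) [hk Fk]] := filterI (hf _ e6) (hF _ e6).
have [/CLp1P ihk /CLp2P[mhk nhk]] := hP k.
have mFk : Cmeasurable (fourier_int (h k)).
  exact: (Cmeasurable_ft mu (measurable_heis_inner (n := n)) mhk).
apply: (le_trans (integral_nsq_le mu mf mhk)).
rewrite -(plancherel_heis ihk nhk).
apply: (@le_trans _ _ (2%:E * (2%:E * \int[mu]_x (nsq (F x))%:E + 2%:E * (e / 6)%:E)
  + 2%:E * (e / 6)%:E)%E).
  apply: leeD; last by rewrite lee_wpmul2l// ltW.
  rewrite lee_wpmul2l//; apply: (le_trans (integral_nsq_le mu mFk mF)).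
  rewrite leeD2l// lee_wpmul2l//; rewrite integral_nsqBC; exact: ltW.
case: (\int[mu]_x (nsq (F x))%:E)%E nF (integral_nsq_ge0 mu F) => // x _ _.
by rewrite lee_fin; lra.
Qed.

End fourier_heis.

(** * Invariance of the Haar measure *)

(** Invariance is stated for integrals of nonnegative functions rather than for sets, the form that
    passes through Tonelli's theorem and is used on |psi|^2. *)
Definition preserves {d} {T : measurableType d} {R : realType}
    (m : set T -> \bar R) (phi : T -> T) : Prop :=
  measurable_fun setT phi /\ forall F : T -> \bar R, measurable_fun setT F ->
  (forall x, 0 <= F x)%E -> (\int[m]_x F (phi x) = \int[m]_x F x)%E.

Section skew.
Context {d1 d2} {T1 : measurableType d1} {T2 : measurableType d2} {R : realType}.
Variable m1 : {sigma_finite_measure set T1 -> \bar R}.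
Variable m2 : {sigma_finite_measure set T2 -> \bar R}.

(** By Tonelli, each fibre map is removed first, then the base map. The fibre map may depend on the
    base point, as Heisenberg translations require: they shift t by an amount depending on (p,
    q). *)
Lemma preserves_skew (phi1 : T1 -> T1) (phi2 : T1 -> T2 -> T2) :
  measurable_fun setT (fun z : T1 * T2 => phi2 z.1 z.2) ->
  preserves m1 phi1 -> (forall x, preserves m2 (phi2 x)) ->
  preserves (sfprod m1 m2) (fun z => (phi1 z.1, phi2 z.1 z.2)).
Proof.
move=> mphi2 [mphi1 p1] p2.
have mphi : measurable_fun setT (fun z : T1 * T2 => (phi1 z.1, phi2 z.1 z.2)).
  by apply: measurable_fun_pair => //; exact: (measurableT_comp mphi1 measurable_fst).
split => // F mF F0.
have mFphi : measurable_fun setT (fun z : T1 * T2 => F (phi1 z.1, phi2 z.1 z.2)).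
  exact: (measurableT_comp mF mphi).
rewrite [LHS](fubini_tonelli1 (m1 := m1) (m2 := m2) _ mFphi (fun z => F0 _)).
rewrite [RHS](fubini_tonelli1 (m1 := m1) (m2 := m2) _ mF F0).
rewrite -[RHS]p1; first last.
- by move=> x; exact: integral_ge0.
- exact: (measurable_fun_fubini_tonelli_F (m2 := m2) _ mF F0).
apply: eq_integral => x _; rewrite /fubini_F /=.
have [_ /(_ (fun y => F (phi1 x, y))) ->//] := p2 x.
exact: (measurableT_comp mF (measurable_pair1 _)).
Qed.

End skew.

Section translations.
Context {R : realType}.
Local Notation mR := (measurableTypeR R).

Lemma preserves_shift (u : R) :
  preserves (@lebesgue_measure R) ((fun t : R => t + u) : mR -> mR).
Proof.
split=> [|F mF F0]; first exact: measurable_shift.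
apply/esym.
exact: (ge0_integral_transport (m1 := @lebesgue_measure R) (m2 := @lebesgue_measure R)
  (measurable_shift u) (lebesgue_measure_shift u)).
Qed.

Lemma measurable_addt2 d (T : measurableType d) n (f g : T -> n.-tuple mR) :
  measurable_fun setT f -> measurable_fun setT g ->
  measurable_fun setT (fun x => addt (f x) (g x)).
Proof.
move=> mf mg; apply/measurable_fun_tnthP => i.
rewrite (_ : _ \o _ = (fun x => (tnth (f x) i : R) + (tnth (g x) i : R))).
  apply: measurable_funD.
    exact: (measurableT_comp (@measurable_tnth _ _ n i) mf).
  exact: (measurableT_comp (@measurable_tnth _ _ n i) mg).
by apply/funext => x; rewrite /= tnth_mktuple.
Qed.

Lemma addt_tcons n (z : mR * n.-tuple mR) (u : n.+1.-tuple mR) :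
  addt (tcons z) u = tcons ((z.1 : R) + (thead u : R), addt z.2 [tuple of behead u]).
Proof.
apply: eq_from_tnth => i; rewrite tnth_mktuple.
case: (unliftP ord0 i) => [j ->|->].
  rewrite (tuple_eta u) /tcons /= !tnthS tnth_mktuple; congr (_ + _).
  by rewrite /thead /=; congr tnth; exact: val_inj.
by rewrite /tcons /= !tnth0.
Qed.

Lemma preserves_addt n (u : n.-tuple mR) :
  preserves (lebesgue_tuple R n) (fun p => addt p u).
Proof.
have mphi n' (v : n'.-tuple mR) : measurable_fun setT (fun p : n'.-tuple mR => addt p v).
  by apply: measurable_addt2.
elim: n u => [|n IH] u; (split; first exact: mphi) => F mF F0.
  by apply: eq_integral => p _; congr F; rewrite [RHS]tuple0; exact: tuple0.
have tr (G : n.+1.-tuple mR -> \bar R) : measurable_fun setT G -> (forall x, 0 <= G x)%E ->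
    (\int[lebesgue_tuple R n.+1]_x G x =
     \int[sfprod (@lebesgue_measure R) (lebesgue_tuple R n)]_z G (tcons z))%E.
  move=> mG G0.
  exact: (ge0_integral_transport (m1 := sfprod (@lebesgue_measure R) (lebesgue_tuple R n))
    (m2 := lebesgue_tuple R n.+1) measurable_tcons).
rewrite !tr//; last exact: (measurableT_comp mF (mphi _ u)).
under eq_integral do rewrite addt_tcons.
have [_ /(_ (fun z => F (tcons z))) ->//] := preserves_skew (m1 := @lebesgue_measure R) (m2 := lebesgue_tuple R n)
  (phi2 := fun _ p => addt p [tuple of behead u])
  (measurableT_comp (mphi _ _) measurable_snd)
  (preserves_shift (thead u)) (fun _ => IH [tuple of behead u]).
exact: (measurableT_comp mF measurable_tcons).
Qed.

Lemma addtC n (p q : n.-tuple mR) : addt p q = addt q p.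
Proof. by apply: eq_from_tnth => i; rewrite !tnth_mktuple addrC. Qed.

Lemma measurable_heis_mul n :
  measurable_fun setT (fun z : heis R n * heis R n => heis_mul z.1 z.2).
Proof.
rewrite (_ : (fun _ => _) = (fun z : heis R n * heis R n =>
  (addt z.1.1.1 z.2.1.1, addt z.1.1.2 z.2.1.2,
   (z.1.2 : R) + (z.2.2 : R) + 2^-1 * (dot z.1.1.1 z.2.1.2 - dot z.1.1.2 z.2.1.1)))); last first.
  by apply/funext => -[[[p q] t] [[p' q'] t']].
have m11 : measurable_fun setT (fun z : heis R n * heis R n => z.1.1).
  exact: (measurableT_comp measurable_fst measurable_fst).
have m21 : measurable_fun setT (fun z : heis R n * heis R n => z.2.1).
  exact: (measurableT_comp measurable_fst measurable_snd).
have m111 : measurable_fun setT (fun z : heis R n * heis R n => z.1.1.1).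
  exact: (measurableT_comp measurable_fst m11).
have m112 : measurable_fun setT (fun z : heis R n * heis R n => z.1.1.2).
  exact: (measurableT_comp measurable_snd m11).
have m211 : measurable_fun setT (fun z : heis R n * heis R n => z.2.1.1).
  exact: (measurableT_comp measurable_fst m21).
have m212 : measurable_fun setT (fun z : heis R n * heis R n => z.2.1.2).
  exact: (measurableT_comp measurable_snd m21).
apply: measurable_fun_pair.
  by apply: measurable_fun_pair; exact: measurable_addt2.
apply: measurable_funD.
  apply: measurable_funD.
    exact: (measurableT_comp measurable_snd measurable_fst).
  exact: (measurableT_comp measurable_snd measurable_snd).
apply: measurable_funM => //; apply: measurable_funB.
  exact: (measurableT_comp (@measurable_dot R n) (measurable_fun_pair m111 m212)).
exact: (measurableT_comp (@measurable_dot R n) (measurable_fun_pair m112 m211)).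
Qed.

Lemma preserves_tuple2 n (u v : n.-tuple mR) :
  preserves (sfprod (lebesgue_tuple R n) (lebesgue_tuple R n))
    (fun z => (addt z.1 u, addt z.2 v)).
Proof.
apply: (@preserves_skew _ _ _ _ _ (lebesgue_tuple R n) (lebesgue_tuple R n)
  (fun p => addt p u) (fun _ p => addt p v)).
- exact: (measurableT_comp (preserves_addt v).1 measurable_snd).
- exact: preserves_addt.
- by move=> _; exact: preserves_addt.
Qed.

(** For fixed P the last coordinate of X is shifted by t' + (p q' - q p')/2, a function of the first
    two coordinates of X: a skew product of translations. *)
Lemma preserves_heis_mulr n (P : heis R n) :
  preserves (lebesgue_heis R n) (fun X => heis_mul X P).
Proof.
case: P => [[p' q'] t'].
rewrite (_ : (fun X => _) = (fun X : heis R n => ((addt X.1.1 p', addt X.1.2 q'),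
  (X.2 : R) + ((t' : R) + 2^-1 * (dot X.1.1 q' - dot X.1.2 p'))))); last first.
  by apply/funext => -[[p q] t] /=; rewrite addrA.
apply: (@preserves_skew _ _ _ _ _
  (sfprod (lebesgue_tuple R n) (lebesgue_tuple R n)) (@lebesgue_measure R)
  (fun z => (addt z.1 p', addt z.2 q'))
  (fun X t => (t : R) + ((t' : R) + 2^-1 * (dot X.1 q' - dot X.2 p')))).
- apply: measurable_funD; first exact: measurable_snd.
  apply: measurable_funD => //; apply: measurable_funM => //; apply: measurable_funB.
    apply: (measurableT_comp (@measurable_dot R n) (_ : measurable_fun setT
      (fun z : heis R n => (z.1.1, q')))).
    by apply: measurable_fun_pair => //;
      exact: (measurableT_comp measurable_fst measurable_fst).
  apply: (measurableT_comp (@measurable_dot R n) (_ : measurable_fun setT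
    (fun z : heis R n => (z.1.2, p')))).
  by apply: measurable_fun_pair => //;
    exact: (measurableT_comp measurable_snd measurable_fst).
- exact: preserves_tuple2.
- by move=> X; exact: preserves_shift.
Qed.

(** The same skew structure in the other factor, needed to integrate |psi(X . P)|^2 in P for fixed
    X. *)
Lemma preserves_heis_mull n (X : heis R n) :
  preserves (lebesgue_heis R n) (fun P => heis_mul X P).
Proof.
case: X => [[p q] t].
rewrite (_ : (fun P => _) = (fun P : heis R n => ((addt P.1.1 p, addt P.1.2 q),
  (P.2 : R) + ((t : R) + 2^-1 * (dot p P.1.2 - dot q P.1.1))))); last first.
  apply/funext => -[[p' q'] t'] /=; congr ((_, _), _); [exact: addtC|exact: addtC|].
  by rewrite addrA [(t' : R) + t]addrC.
apply: (@preserves_skew _ _ _ _ _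
  (sfprod (lebesgue_tuple R n) (lebesgue_tuple R n)) (@lebesgue_measure R)
  (fun z => (addt z.1 p, addt z.2 q))
  (fun P t' => (t' : R) + ((t : R) + 2^-1 * (dot p P.2 - dot q P.1)))).
- apply: measurable_funD; first exact: measurable_snd.
  apply: measurable_funD => //; apply: measurable_funM => //; apply: measurable_funB.
    apply: (measurableT_comp (@measurable_dot R n) (_ : measurable_fun setT
      (fun z : heis R n => (p, z.1.2)))).
    by apply: measurable_fun_pair => //;
      exact: (measurableT_comp measurable_snd measurable_fst).
  apply: (measurableT_comp (@measurable_dot R n) (_ : measurable_fun setT
    (fun z : heis R n => (q, z.1.1)))).
  by apply: measurable_fun_pair => //;
    exact: (measurableT_comp measurable_fst measurable_fst).
- exact: preserves_tuple2.
- by move=> P; exact: preserves_shift.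
Qed.

End translations.

(** * Boxes of small measure around the origin *)

Definition cube {R : realType} (n : nat) : set (n.-tuple (measurableTypeR R)) :=
  [set p | forall i, `|tnth p i : R| <= 1].
Arguments cube {R} n.

Section box.
Context {R : realType}.
Local Notation mR := (measurableTypeR R).

Lemma measurable_cube n : measurable (@cube R n).
Proof.
rewrite (_ : cube n = \bigcap_(i in [set: 'I_n])
    ((fun p : n.-tuple mR => tnth p i) @^-1` [set` `[-1 : R, 1]])).
  apply: fin_bigcap_measurable; first exact: finite_finset.
  move=> i _; rewrite -[X in measurable X]setTI.
  exact: (@measurable_tnth _ _ n i measurableT _ (measurable_itv `[-1 : R, 1])).
apply/seteqP; split => p /= h i.
  by move=> _; rewrite /= in_itv/= -ler_norml.
by have := h i I; rewrite /= in_itv/= -ler_norml.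
Qed.

Lemma lebesgue_measure_itvN (r : R) : 0 <= r ->
  lebesgue_measure ([set` `[- r, r]] : set mR) = (2 * r)%:E.
Proof.
move=> r0; rewrite [LHS]lebesgue_measure_itv/= lte_fin.
case: ltP => rr; first by rewrite -EFinB; congr EFin; ring.
by congr EFin; lra.
Qed.

Lemma cube_lty n : (lebesgue_tuple R n (cube n) < +oo)%E.
Proof.
elim: n => [|n IH]; first by rewrite /= diracE ltry.
rewrite /= /lebesgue_cons /pushforward.
rewrite (_ : _ @^-1` _ = [set` `[-1 : R, 1]] `*` cube n).
  rewrite [X in (X < _)%E](@product_measure1E _ _ _ _ _ (@lebesgue_measure R)
    (lebesgue_tuple R n)); [|exact: (measurable_itv `[-1 : R, 1])|exact: measurable_cube].
  rewrite lte_mul_pinfty//.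
    rewrite ge0_fin_numE//.
    by rewrite [X in (X < _)%E](lebesgue_measure_itvN ler01) ltry.
apply/seteqP; split => [[a p] h|[a p] [/= h1 h2] i] /=.
  split => /=.
    by rewrite in_itv/= -ler_norml; have := h ord0; rewrite /tcons tnth0.
  by move=> i; have := h (lift ord0 i); rewrite /tcons tnthS.
rewrite /tcons /=; case: (unliftP ord0 i) => [j ->|->]; first by rewrite tnthS.
by rewrite tnth0; move: h1; rewrite in_itv/= -ler_norml.
Qed.

End box.

(** * The short-time Fourier transform *)

Section small_box.
Context {R : realType} {n : nat}.
Local Notation mR := (measurableTypeR R).
Local Notation mu := (lebesgue_heis R n).

(** Only the last coordinate is scaled, so the measure is linear in r and finiteness of the measure
    of the cube is all that has to be known about it. *)
Definition slab (r : R) : set (heis R n) :=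
  (cube n `*` cube n) `*` [set` `[- r, r]].

Lemma measurable_slab r : measurable (slab r).
Proof.
apply: measurableX; last exact: (measurable_itv `[- r, r]).
by apply: measurableX; exact: measurable_cube.
Qed.

Lemma slab_measure r : 0 <= r ->
  mu (slab r) = (fine (lebesgue_tuple R n (cube n)) ^+ 2 * (2 * r))%:E.
Proof.
move=> r0.
rewrite [LHS](@product_measure1E _ _ _ _ _
  (sfprod (lebesgue_tuple R n) (lebesgue_tuple R n)) (@lebesgue_measure R)); first last.
- exact: (measurable_itv `[- r, r]).
- by apply: measurableX; exact: measurable_cube.
rewrite [X in (X * _)%E](@product_measure1E _ _ _ _ _ (lebesgue_tuple R n)
  (lebesgue_tuple R n)); [|exact: measurable_cube|exact: measurable_cube].
rewrite [X in (_ * X)%E](lebesgue_measure_itvN r0).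
have [m mE] : exists m, lebesgue_tuple R n (cube n) = m%:E.
  exists (fine (lebesgue_tuple R n (cube n))).
  by rewrite fineK// ge0_fin_numE//; exact: cube_lty.
transitivity (lebesgue_tuple R n (cube n) * lebesgue_tuple R n (cube n) * (2 * r)%:E)%E.
  by [].
by rewrite mE /= expr2 !EFinM.
Qed.

(** A substitute for a ball: its measure is a product that tends to 0 with r, and for r <= 1 it
    contains the open ball of radius r. *)
Definition box (r : R) : set (heis R n * heis R n) := slab 1 `*` slab r.

Lemma measurable_box r : measurable (box r).
Proof. by apply: measurableX; exact: measurable_slab. Qed.

Lemma small_box (e : R) : 0 < e -> exists r : R,
  [/\ 0 < r, r <= 1 & (sfprod mu mu (box r) <= e%:E)%E].
Proof.
(* The measure of [box r] is D r; the denominator D + 1 below is positive even if D = 0. *)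
move=> e0; pose D := 4 * (fine (lebesgue_tuple R n (cube n)) ^+ 2) ^+ 2.
have D0 : 0 <= D by rewrite mulr_ge0 ?sqr_ge0.
pose r := Num.min 1 (e / (D + 1)).
have r0 : 0 < r by rewrite lt_min ltr01 divr_gt0// ltr_wpDl.
exists r; split => //; first by rewrite ge_min lexx.
rewrite [X in (X <= _)%E](@product_measure1E _ _ _ _ _ mu mu);
  [|exact: measurable_slab|exact: measurable_slab].
rewrite [X in (X * _)%E](slab_measure ler01) [X in (_ * X)%E](slab_measure (ltW r0)).
rewrite lee_fin.
have : r <= e / (D + 1) by rewrite ge_min lexx orbT.
rewrite ler_pdivlMr ?ltr_wpDl// => rD.
apply: le_trans rD; rewrite mulrDr mulr1; apply: (@le_trans _ _ (r * D)).
  by rewrite le_eqVlt; apply/orP; left; apply/eqP; rewrite /D; ring.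
by rewrite lerDl ltW.
Qed.

Lemma dot_ge0 (p : n.-tuple mR) : 0 <= dot p p.
Proof. by apply: sumr_ge0 => i _; rewrite -expr2 sqr_ge0. Qed.

Lemma le_tnth_dot (p : n.-tuple mR) i : (tnth p i : R) ^+ 2 <= dot p p.
Proof.
rewrite /dot (bigD1 i)//= -expr2 lerDl sumr_ge0// => j _.
by rewrite -expr2 sqr_ge0.
Qed.

Lemma heis_inner_ge0 (X : heis R n) : 0 <= heis_inner X X.
Proof. by rewrite /heis_inner !addr_ge0 ?dot_ge0// -expr2 sqr_ge0. Qed.

Lemma slabP (X : heis R n) (e r : R) : heis_inner X X <= e ^+ 2 ->
  0 <= e -> e <= r -> e <= 1 -> slab r X.
Proof.
case: X => [[p q] t] /=; rewrite /heis_inner /= -expr2 => h e0 er e1.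
have key (x c : R) : x ^+ 2 <= e ^+ 2 -> e <= c -> `|x| <= c.
  move=> xe; apply: le_trans.
  rewrite -(ler_pXn2r (ltn0Sn 1)) ?nnegrE//.
  by rewrite real_normK// num_real.
have := dot_ge0 p; have := dot_ge0 q; have := sqr_ge0 (t : R) => t0 q0 p0.
split; last first.
  by rewrite /= in_itv/= -ler_norml; apply: key => //; lra.
split=> i; apply: key => //.
- by have := le_tnth_dot p i; lra.
- by have := le_tnth_dot q i; lra.
Qed.

Lemma pair_norm_ge (Z : heis R n * heis R n) (r : R) : r <= 1 ->
  ~ box r Z -> r <= pair_norm Z.
Proof.
move=> r1 nb; rewrite leNgt; apply/negP => Zr; apply: nb.
have Z0 : 0 <= pair_norm Z by exact: sqrtr_ge0.
have ZE : heis_inner Z.1 Z.1 + heis_inner Z.2 Z.2 = pair_norm Z ^+ 2.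
  by rewrite sqr_sqrtr// addr_ge0// heis_inner_ge0.
have := heis_inner_ge0 Z.1; have := heis_inner_ge0 Z.2 => h2 h1.
split; apply: (@slabP _ (pair_norm Z)) => //; lra.
Qed.

Lemma measurable_pair_norm : measurable_fun setT (@pair_norm R n).
Proof.
apply: measurableT_comp; first by apply: continuous_measurable_fun; exact: sqrt_continuous.
have mi := @measurable_heis_inner R n.
apply: measurable_funD.
- apply: (measurableT_comp mi (_ : measurable_fun setT
    (fun Z : heis R n * heis R n => (Z.1, Z.1)))).
  by apply: measurable_fun_pair; exact: measurable_fst.
- apply: (measurableT_comp mi (_ : measurable_fun setT
    (fun Z : heis R n * heis R n => (Z.2, Z.2)))).
  by apply: measurable_fun_pair; exact: measurable_snd.
Qed.

End small_box.

Section stft.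
Context {R : realType} {n : nat}.
Local Notation mu := (lebesgue_heis R n).
Variables phi psi : heis R n -> R[i].
Hypotheses (mphi : Cmeasurable phi) (mpsi : Cmeasurable psi).
Variables a b : R.
Hypothesis phia : (\int[mu]_X (nsq (phi X))%:E = a%:E)%E.
Hypothesis psib : (\int[mu]_X (nsq (psi X))%:E = b%:E)%E.

Let H (P X : heis R n) : R[i] := phi X * (psi (heis_mul X P))^*%C.

(** For fixed P this is a Fourier transform in X, to which Plancherel's identity applies. With phi =
    [fourier f] and psi = [fourier g] it is [stft g f] by conversion. *)
Definition stft_of (Z : heis R n * heis R n) : R[i] := ft mu heis_inner (H Z.2) Z.1.

Let mH : Cmeasurable (fun z : heis R n * heis R n => H z.1 z.2).
Proof.
apply: CmeasurableM; first exact: (Cmeasurable_comp measurable_snd mphi).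
apply: Cmeasurable_conj.
apply: (@Cmeasurable_comp _ _ _ _ _
  (fun z : heis R n * heis R n => heis_mul z.2 z.1) psi) => //.
apply: (measurableT_comp (@measurable_heis_mul R n) (_ : measurable_fun setT
  (fun z : heis R n * heis R n => (z.2, z.1)))).
by apply: measurable_fun_pair; [exact: measurable_snd|exact: measurable_fst].
Qed.

Let mHP P : Cmeasurable (H P).
Proof. exact: (Cmeasurable_comp (measurable_pair1 P) mH). Qed.

Let mnphi : measurable_fun setT (fun X => (nsq (phi X))%:E).
Proof. by apply/measurable_EFinP; exact: measurable_nsq. Qed.

Let mnpsi : measurable_fun setT (fun X => (nsq (psi X))%:E).
Proof. by apply/measurable_EFinP; exact: measurable_nsq. Qed.

Let psi_mulr P : (\int[mu]_X (nsq (psi (heis_mul X P)))%:E = b%:E)%E.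
Proof.
rewrite -psib; have [_] := preserves_heis_mulr P.
by move=> /(_ (fun X => (nsq (psi X))%:E)); apply => // X; rewrite lee_fin nsq_ge0.
Qed.

Let mnpsi_mulr P : measurable_fun setT (fun X => (nsq (psi (heis_mul X P)))%:E).
Proof. exact: (measurableT_comp mnpsi (preserves_heis_mulr P).1). Qed.

Let normc_H P X (t : R) : 0 < t ->
  Normc.normc (H P X) <= 2^-1 * t * nsq (phi X) + 2^-1 * t^-1 * nsq (psi (heis_mul X P)).
Proof.
move=> t0.
have -> : Normc.normc (H P X) = Normc.normc (phi X) * Normc.normc (psi (heis_mul X P)).
  apply/eqP; rewrite -(eqrXn2 (ltn0Sn 1)) ?mulr_ge0 ?normc_ge0//.
  by rewrite exprMn !sqr_normcE nsqM nsq_conj.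
rewrite -!sqr_normcE; set p := Normc.normc _; set q := Normc.normc _.
rewrite -subr_ge0 (_ : _ - _ = 2^-1 * t^-1 * (t * p - q) ^+ 2); last first.
  by field; rewrite gt_eqF.
by rewrite mulr_ge0 ?sqr_ge0// mulr_ge0// invr_ge0 ltW.
Qed.

Let integral_normc_H P (t : R) : 0 < t ->
  (\int[mu]_X (Normc.normc (H P X))%:E <= (2^-1 * t * a + 2^-1 * t^-1 * b)%:E)%E.
Proof.
move=> t0.
have c1 : (0 <= (2^-1 * t)%:E)%E by rewrite lee_fin mulr_ge0// ltW.
have c2 : (0 <= (2^-1 * t^-1)%:E)%E by rewrite lee_fin mulr_ge0// invr_ge0 ltW.
have p1 X : (0 <= (nsq (phi X))%:E)%E by rewrite lee_fin nsq_ge0.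
have p2 X : (0 <= (nsq (psi (heis_mul X P)))%:E)%E by rewrite lee_fin nsq_ge0.
rewrite EFinD EFinM [X in (_ <= _ + X)%E]EFinM -phia -(psi_mulr P).
rewrite -!ge0_integralZl// -ge0_integralD//; first last.
- exact: measurable_funeM.
- by move=> X _; rewrite mule_ge0.
- exact: measurable_funeM.
- by move=> X _; rewrite mule_ge0.
apply: ge0_le_integral => //.
- by move=> X _; rewrite lee_fin normc_ge0.
- by apply/measurable_EFinP; exact: measurable_normc.
- by apply: emeasurable_funD; exact: measurable_funeM.
- by move=> X _; rewrite -!EFinM -EFinD lee_fin normc_H.
Qed.

Let HL1 P : Cintegrable mu (H P).
Proof.
apply/CLp1P; split; [exact: (mHP P).1|exact: (mHP P).2|].
rewrite /CLnorm Lnorm1.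
rewrite (eq_integral (fun X => (Normc.normc (H P X))%:E)).
  by rewrite (le_lt_trans (integral_normc_H P ltr01))// ltry.
by move=> X _; rewrite /= ger0_norm ?normc_ge0.
Qed.

(* AM-GM, [|u v| <= (t |u|^2 + |v|^2 / t) / 2] with t^2 = b / a, plays the role
   of the Cauchy-Schwarz inequality; the factor 2 comes from bounding the real
   and imaginary parts separately. *)
Lemma nsq_stft_le Z : 0 < a -> 0 < b -> nsq (stft_of Z) <= 2 * (a * b).
Proof.
move=> a0 b0.
have ba : 0 < b / a by rewrite divr_gt0.
pose t := Num.sqrt (b / a).
have t0 : 0 < t by rewrite sqrtr_gt0.
have tt : t ^+ 2 = b / a by rewrite sqr_sqrtr// ltW.
pose I := 2^-1 * t * a + 2^-1 * t^-1 * b.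
have I2 : I ^+ 2 = a * b.
  have bE : b = t ^+ 2 * a by rewrite tt mulfVK// gt_eqF.
  by rewrite /I bE; field; rewrite gt_eqF.
have mk : Cmeasurable (fun X => H Z.2 X * expi (- (2 * pi * heis_inner Z.1 X))).
  apply: CmeasurableM => //; exact: (measurable_character (@measurable_heis_inner R n)).
have nk : (\int[mu]_X (Normc.normc
    (H Z.2 X * expi (- (2 * pi * heis_inner Z.1 X))))%:E <= I%:E)%E.
  rewrite (eq_integral (fun X => (Normc.normc (H Z.2 X))%:E)).
    exact: integral_normc_H.
  by move=> X _; rewrite normcM_expi.
have := le_trans (normr_Re_Cintegral mu mk) nk.
have := le_trans (normr_Im_Cintegral mu mk) nk.
rewrite !lee_fin -/(ft mu heis_inner (H Z.2) Z.1) -/(stft_of Z) => hI hR.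
have sq (x : R) : `|x| <= I -> x ^+ 2 <= a * b.
  move=> xI; rewrite -I2 -(real_normK (num_real x)).
  by rewrite ler_pXn2r ?nnegrE// (le_trans _ xI).
by rewrite /nsq (mulr_natl _ 2) mulr2n lerD// sq.
Qed.

Lemma Cmeasurable_stft_of : Cmeasurable stft_of.
Proof.
have h := Cmeasurable_ft2 mu (@measurable_heis_inner R n) mH.
apply: (@Cmeasurable_comp _ _ _ _ _
  (fun Z : heis R n * heis R n => (Z.2, Z.1)) _ _ h).
by apply: measurable_fun_pair; [exact: measurable_snd|exact: measurable_fst].
Qed.

(** The orthogonality relation for the short-time transform. Plancherel's identity removes the
    integral in Q; after exchanging X and P, the map P |-> X . P is a left translation, and the
    integral factors. *)
Lemma integral_nsq_stft :
  (\int[sfprod mu mu]_Z (nsq (stft_of Z))%:E = (a * b)%:E)%E.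
Proof.
have mHn : measurable_fun setT (fun z : heis R n * heis R n => nsq (H z.1 z.2)).
  exact: measurable_nsq.
have HE : (\int[mu]_P \int[mu]_X (nsq (H P X))%:E = (a * b)%:E)%E.
  rewrite (sf_tonelli mu mu (f := fun z => nsq (H z.1 z.2)))//; last first.
    by move=> z; exact: nsq_ge0.
  transitivity (\int[mu]_X ((nsq (phi X))%:E * b%:E))%E.
    apply: eq_integral => X _ /=.
    under eq_integral do rewrite /H nsqM nsq_conj EFinM.
    have mX : measurable_fun setT (fun P => (nsq (psi (heis_mul X P)))%:E).
      exact: (measurableT_comp mnpsi (preserves_heis_mull X).1).
    rewrite ge0_integralZl//; last 2 first.
    - by move=> P _; rewrite lee_fin nsq_ge0.
    - by rewrite lee_fin nsq_ge0.
    congr (_ * _)%E; rewrite -psib; have [_] := preserves_heis_mull X.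
    by move=> /(_ (fun X => (nsq (psi X))%:E)); apply => // Y; rewrite lee_fin nsq_ge0.
  rewrite ge0_integralZr//.
  - by rewrite phia.
  - by move=> X _; rewrite lee_fin nsq_ge0.
  - by rewrite -psib integral_nsq_ge0.
rewrite sf_tonelli2; last 2 first.
- exact: measurable_nsq Cmeasurable_stft_of.
- by move=> Z; exact: nsq_ge0.
rewrite -HE; apply: ge0_ae_eq_integral; [by []|..].
- have := measurable_nsq Cmeasurable_stft_of => mV.
  apply: (sf_measurable1 mu (f := fun z => nsq (stft_of (z.2, z.1)))).
    apply: (measurableT_comp mV).
    by apply: measurable_fun_pair; [exact: measurable_snd|exact: measurable_fst].
  by move=> z; exact: nsq_ge0.
- apply: (sf_measurable1 mu (f := fun z => nsq (H z.1 z.2))) => //.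
  by move=> z; exact: nsq_ge0.
- by move=> P _; exact: integral_nsq_ge0.
- by move=> P _; exact: integral_nsq_ge0.
(* H(P, .) is integrable for every P, but its square integrability comes from Tonelli and holds for
   almost every P. *)
- have iH : (mu \x mu)%E.-integrable setT (EFin \o (fun z => nsq (H z.1 z.2))).
    apply/integrable_nsqP => //.
    rewrite [X in (X < _)%E](sf_tonelli1 mu mu mHn); last first.
      by move=> z; exact: nsq_ge0.
    by rewrite HE ltry.
  have := ae_integrable1 (m1 := mu) (m2 := mu) iH.
  apply: filterS => P iHP _.
  apply: (plancherel_heis (HL1 P)).
  exact: (integrable_nsqP mu (mHP P)).1.
Qed.

End stft.

(** * The uncertainty inequality *)

Section uncertainty.
Context {R : realType} {n : nat}.
Local Notation mu := (lebesgue_heis R n).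

Lemma weighted_stft_ge (s r : R) (phi psi : heis R n -> R[i]) (a b : R) :
  0 < s -> 0 < r -> r <= 1 ->
  (sfprod mu mu (@box R n r) <= (4^-1)%:E)%E ->
  Cmeasurable phi -> Cmeasurable psi -> 0 < a -> 0 < b ->
  (\int[mu]_X (nsq (phi X))%:E = a%:E)%E ->
  (\int[mu]_X (nsq (psi X))%:E = b%:E)%E ->
  (((r `^ s) ^+ 2 * (2^-1 * (a * b)))%:E <=
   \int[sfprod mu mu]_Z (nsq ((pair_norm Z `^ s)%:C%C * stft_of phi psi Z))%:E)%E.
Proof.
move=> s0 r0 r1 Sr mphi mpsi a0 b0 phia psib.
set V := stft_of phi psi; set S := @box R n r.
have mS : measurable S by exact: measurable_box.
have mV : Cmeasurable V by exact: Cmeasurable_stft_of.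
have mnV : measurable_fun setT (fun Z => nsq (V Z)) by exact: measurable_nsq.
have ab0 : 0 < a * b by rewrite mulr_gt0.
have mI (A : set (heis R n * heis R n)) : measurable A ->
    measurable_fun setT (\1_A : _ -> R) by exact: measurable_indic.
have mVI (A : set (heis R n * heis R n)) : measurable A ->
    measurable_fun setT (fun Z => nsq (V Z) * \1_A Z).
  by move=> mA; apply: measurable_funM => //; exact: mI.
have VI0 (A : set (heis R n * heis R n)) Z : 0 <= nsq (V Z) * \1_A Z.
  by rewrite mulr_ge0 ?nsq_ge0// indicE ler0n.
(* The pointwise bound 2 a b times the measure of the box, at most 1/4, gives half of the total a
   b. *)
have inS : (\int[sfprod mu mu]_Z (nsq (V Z) * \1_S Z)%:E <= (2^-1 * (a * b))%:E)%E.
  apply: (@le_trans _ _ (\int[sfprod mu mu]_Z ((2 * (a * b))%:E * (\1_S Z)%:E))%E).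
    apply: ge0_le_integral => //.
    - by move=> Z _; rewrite lee_fin.
    - by apply/measurable_EFinP; exact: mVI.
    - by apply: measurable_funeM; apply/measurable_EFinP; exact: mI.
    - move=> Z _; rewrite lee_fin ler_wpM2r ?indicE ?ler0n//.
      exact: (nsq_stft_le mphi mpsi phia psib).
  rewrite ge0_integralZl//; last 2 first.
  - by apply/measurable_EFinP; exact: mI.
  - by rewrite lee_fin mulr_ge0// ltW.
  rewrite integral_indic// setIT.
  apply: (@le_trans _ _ ((2 * (a * b))%:E * (4^-1)%:E)%E).
    by rewrite lee_wpmul2l// lee_fin mulr_ge0// ltW.
  by rewrite -EFinM lee_fin le_eqVlt; apply/orP; left; apply/eqP; field.
(* Both sides are compared after adding a b / 2, which avoids a subtraction of extended reals. *)
have outS : ((2^-1 * (a * b))%:E <= \int[sfprod mu mu]_Z (nsq (V Z) * \1_(~` S) Z)%:E)%E.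
  have : ((a * b)%:E = \int[sfprod mu mu]_Z (nsq (V Z) * \1_S Z)%:E +
      \int[sfprod mu mu]_Z (nsq (V Z) * \1_(~` S) Z)%:E)%E.
    rewrite -ge0_integralD//; last 4 first.
    - by move=> Z _; rewrite lee_fin.
    - by apply/measurable_EFinP; exact: mVI.
    - by move=> Z _; rewrite lee_fin.
    - by apply/measurable_EFinP; apply: mVI; exact: measurableC.
    rewrite -(integral_nsq_stft mphi mpsi phia psib); apply: eq_integral => Z _.
    rewrite -EFinD !indicE in_setC; congr EFin.
    by case: (Z \in S); rewrite /= ?mulr1 ?mulr0 ?addr0 ?add0r.
  move=> E; rewrite -(leeD2lE (x := (2^-1 * (a * b))%:E))//.
  apply: (@le_trans _ _ (a * b)%:E); first by rewrite -EFinD lee_fin -mulrDl -div1r -splitr mul1r.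
  by rewrite E leeD2r.
apply: (@le_trans _ _ (((r `^ s) ^+ 2)%:E *
    \int[sfprod mu mu]_Z (nsq (V Z) * \1_(~` S) Z)%:E)%E).
  by rewrite EFinM lee_wpmul2l// lee_fin sqr_ge0.
rewrite -ge0_integralZl//; last 3 first.
- by apply/measurable_EFinP; apply: mVI; exact: measurableC.
- by move=> Z _; rewrite lee_fin.
- by rewrite lee_fin sqr_ge0.
have mpn : measurable_fun setT (fun Z : heis R n * heis R n => pair_norm Z `^ s).
  by apply: (measurableT_comp (measurable_powR s)); exact: measurable_pair_norm.
apply: ge0_le_integral => //.
- by move=> Z _; rewrite mule_ge0// lee_fin// sqr_ge0.
- apply: measurable_funeM; apply/measurable_EFinP; apply: mVI; exact: measurableC.
- apply/measurable_EFinP; apply: measurable_nsq.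
  by apply: CmeasurableM; [exact: (Cmeasurable_realC mpn)|exact: mV].
- move=> Z _; rewrite -EFinM lee_fin nsqM nsq_realC indicE in_setC.
  case: (boolP (Z \in S)) => [_|/negP ZS] /=.
    by rewrite !mulr0 mulr_ge0 ?sqr_ge0 ?nsq_ge0.
  rewrite mulr1 ler_wpM2r ?nsq_ge0// ler_pXn2r ?nnegrE ?powR_ge0//.
  have rZ : r <= pair_norm Z by apply: pair_norm_ge => // /mem_set.
  by apply: ge0_ler_powR; rewrite ?nnegrE ?(ltW s0) ?(ltW r0) ?sqrtr_ge0.
Qed.

End uncertainty.

Theorem corollary8p3 (R : realType) (n : nat) (hn : (1 <= n)%N)
    (s : R) (hs : 0 < s) :
  exists2 c : R, 0 < c &
    forall f g : heis R n -> R[i],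
      CLp (lebesgue_heis R n) 2%:E f -> CLp (lebesgue_heis R n) 2%:E g ->
      (c%:E * CLnorm (lebesgue_heis R n) 2%:E f
            * CLnorm (lebesgue_heis R n) 2%:E g
       <= CLnorm (lebesgue_heis R n \x lebesgue_heis R n) 2%:E
            (fun Z => (pair_norm Z `^ s)%:C%C * stft g f Z)%R)%E.
Proof.
have quarter : 0 < (4^-1 : R) by rewrite invr_gt0.
have [r [r0 r1 Sr]] := @small_box R n _ quarter.
(* 32 = 2 * 16: the half of the mass outside the box, and the factor 4 of [is_fourier_norm] for each
   of f and g. The radius is fixed before f and g, so the constant depends only on s and n. *)
pose K := (r `^ s) ^+ 2 / 32.
have K0 : 0 < K by rewrite divr_gt0// exprn_gt0// powR_gt0.
exists (Num.sqrt K); first by rewrite sqrtr_gt0.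
move=> f g Lf Lg.
have ff := fourierP Lf; have fg := fourierP Lg.
have nf := is_fourier_norm Lf ff; have ng := is_fourier_norm Lg fg.
have [[/CLp2P[mphi phifin] _] [/CLp2P[mpsi psifin] _]] := (ff, fg).
move: Lf Lg => /CLp2P[mf ffin] /CLp2P[mg gfin].
have fin (h : heis R n -> R[i]) :
    (\int[lebesgue_heis R n]_X (nsq (h X))%:E < +oo)%E ->
    exists2 x, 0 <= x & (\int[lebesgue_heis R n]_X (nsq (h X))%:E)%E = x%:E.
  have := integral_nsq_ge0 (lebesgue_heis R n) h.
  by case: (\int[_]_X _)%E => // x x0 _; exists x.
have [x x0 fx] := fin _ ffin; have [y y0 gy] := fin _ gfin.
have [a a0 phia] := fin _ phifin; have [b b0 psib] := fin _ psifin.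
rewrite (CLnorm2_fin fx) (CLnorm2_fin gy).
rewrite fx phia lee_fin in nf; rewrite gy psib lee_fin in ng.
(* If a transform has norm 0, so does f or g by [is_fourier_norm], and the left-hand side vanishes.
   Otherwise a and b are positive, as the optimal t^2 = b / a in the pointwise bound requires. *)
have [ab|ab] := leP (a * b) 0.
  have : x * y = 0.
    have : a * b = 0 by apply/eqP; rewrite eq_le ab mulr_ge0.
    move=> /eqP; rewrite mulf_eq0 => /orP[/eqP a00|/eqP b00].
      have -> : x = 0 by apply/eqP; rewrite eq_le x0 andbT; move: nf; rewrite a00 mulr0.
      by rewrite mul0r.
    have -> : y = 0 by apply/eqP; rewrite eq_le y0 andbT; move: ng; rewrite b00 mulr0.
    by rewrite mulr0.
  move=> xy; rewrite -!EFinM -mulrA -sqrtrM// xy sqrtr0 mulr0.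
  exact: Lnorm_ge0.
have a1 : 0 < a by rewrite lt_neqAle eq_sym a0 andbT; apply: contraTneq ab => ->; rewrite mul0r ltxx.
have b1 : 0 < b by rewrite lt_neqAle eq_sym b0 andbT; apply: contraTneq ab => ->; rewrite mulr0 ltxx.
have W := weighted_stft_ge hs r0 r1 Sr mphi mpsi a1 b1 phia psib.
rewrite CLnorm2E.
have xyab : Num.sqrt K * Num.sqrt x * Num.sqrt y = Num.sqrt (K * x * y).
  by rewrite (sqrtrM _ (mulr_ge0 (ltW K0) x0)) (sqrtrM _ (ltW K0)).
have Kxy : 0 <= K * x * y := mulr_ge0 (mulr_ge0 (ltW K0) x0) y0.
rewrite -!EFinM xyab -powR12_sqrt//.
rewrite -poweR_EFin; apply: gt0_ler_poweR.
- by rewrite invr_ge0.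
- by rewrite in_itv/= leey andbT lee_fin.
- by rewrite in_itv/= leey andbT; exact: integral_nsq_ge0.
(* This matches [stft g f] with [stft_of], and the product measure with [sfprod], by conversion. *)
apply: le_trans W; rewrite lee_fin.
have xy16 : x * y <= 16 * (a * b).
  by rewrite (_ : 16 * (a * b) = (4 * a) * (4 * b)); [rewrite ler_pM|ring].
rewrite -mulrA (_ : _ * (2^-1 * _) = K * (16 * (a * b))); last by rewrite /K; field.
by rewrite ler_wpM2l// ltW.
Qed.
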